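(* Let $\mathcal{C}$ be a small extriangulated category, $n\geq 0$, and $\mathcal{X}=\mathrm{free}(\mathcal{X})$ an $(n+2)$-rigid subcategory of $\mathcal{C}$ such that $\mathcal{X}_n^{\vee}$ has enough $\mathbb{E}$-projective morphisms from $\mathcal{X}$. Consider the fully faithful functor $\mathbb{F}:\mathcal{X}_{n+1}^{\vee}/[\mathcal{X}]\to\mathrm{fp}\,\underline{\mathcal{X}_n^{\vee}}$, $M\mapsto\underline{\mathbb{E}}(-,M)$. Then the following hold. (a) $\mathrm{Im}(\mathbb{F})\subseteq\mathcal{R}_{\mathcal{X}}^{n}$, $(\mathcal{X}_{n+1}^{\vee}/[\mathcal{X}],\varepsilon_{\mathbb{F}})$ is an exact category, and $\mathbb{F}:\mathcal{X}_{n+1}^{\vee}/[\mathcal{X}]\to\mathcal{R}_{\mathcal{X}}^{n}$ is an equivalence of exact categories. Moreover, if $\mathcal{X}=\mathrm{smd}(\mathcal{X})$, then: (a1) $\mathcal{X}_{n+1}^{\vee}/[\mathcal{X}]$ is weakly idempotent complete if $\mathcal{X}_{n+1}^{\vee}$ has enough deflations from $\mathcal{X}$; (a2) $\mathcal{X}_{n+1}^{\vee}/[\mathcal{X}]$ is Krull–Schmidt if $\mathcal{C}$ is. (b) If $\mathcal{X}_n^{\vee}=\mathcal{X}$ is a precovering class in $\mathcal{X}_{n+1}^{\vee}$, then: (b1) the exact category $(\mathcal{X}_{n+1}^{\vee}/[\mathcal{X}],\varepsilon_{\mathbb{F}})$ is abelian and $\mathbb{F}:\mathcal{X}_{n+1}^{\vee}/[\mathcal{X}]\to\mathrm{fp}\,\underline{\mathcal{X}}$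 is an equivalence of abelian categories; (b2) $\mathrm{Proj}(\mathcal{X}_{n+1}^{\vee}/[\mathcal{X}])=\mathrm{smd}(\Omega(\mathcal{X})/[\mathcal{X}])$ if $\mathcal{C}$ has enough $\mathbb{E}$-projectives and $\mathcal{P}_{\mathbb{E}}(\mathcal{C})\subseteq\mathcal{X}$; if in addition $\mathcal{C}$ is Krull–Schmidt and $\mathcal{X}=\mathrm{smd}(\mathcal{X})$, then $\mathrm{Proj}(\mathcal{X}_{n+1}^{\vee}/[\mathcal{X}])=\Omega(\mathcal{X})/[\mathcal{X}]$ (classes of objects of $\mathcal{X}_{n+1}^{\vee}/[\mathcal{X}]$ taken up to isomorphism).
   Context: All classes of objects are regarded as full subcategories. An extriangulated category $(\mathcal{C},\mathbb{E},\mathfrak{s})$ (in the sense of Nakaoka–Palu) is an additive category $\mathcal{C}$ with an additive bifunctor $\mathbb{E}:\mathcal{C}^{op}\times\mathcal{C}\to Ab$ and an additive realization $\mathfrak{s}$, assigning to each $\delta\in\mathbb{E}(C,A)$ an equivalence class of sequences $A\to B\to C$, satisfying (ET3), (ET3)$^{op}$, (ET4), (ET4)$^{op}$. A sequence $A\xrightarrow{x}B\xrightarrow{y}C$ realizing some $\delta\in\mathbb{E}(C,A)$ is a conflation ($x$ is an inflation, $y$ a deflation), and together with $\delta$ it is an $\mathbb{E}$-triangle $A\to B\to C\dashrightarrow$. A morphism $f$ is $\mathbb{E}$-projective if $\mathbb{E}(f,-)=0$ (class $\mathcal{P}_{1,\mathbb{E}}(\mathcal{C})$) and $\mathbb{E}$-injective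 if $\mathbb{E}(-,f)=0$ (class $\mathcal{I}_{1,\mathbb{E}}(\mathcal{C})$). An object $P$ is $\mathbb{E}$-projective if $\mathcal{C}(P,y)$ is surjective for every deflation $y$; $\mathcal{P}_{\mathbb{E}}(\mathcal{C})$ is the class of these. $\mathcal{C}$ has enough $\mathbb{E}$-projectives if every $C\in\mathcal{C}$ admits a deflation $P\to C$ with $P\in\mathcal{P}_{\mathbb{E}}(\mathcal{C})$. Higher $\mathbb{E}$-extension groups: a family $\{\mathbb{E}^i\}_{i\geq1}$ of additive bifunctors $\mathcal{C}^{op}\times\mathcal{C}\to Ab$ with $\mathbb{E}^1=\mathbb{E}$; for each $\mathbb{E}$-triangle $A\to B\to C\dashrightarrow$ and each $i\geq 1$ there are natural transformations $\mathbb{E}^i(A,-)\to\mathbb{E}^{i+1}(C,-)$ and $\mathbb{E}^i(-,C)\to\mathbb{E}^{i+1}(-,A)$, compatible with morphisms of $\mathbb{E}$-triangles, making $\mathbb{E}^i(C,-)\to\mathbb{E}^i(B,-)\to\mathbb{E}^i(A,-)\to\mathbb{E}^{i+1}(C,-)$ and $\mathbb{E}^i(-,A)\to\mathbb{E}^i(-,B)\to\mathbb{E}^i(-,C)\to\mathbb{E}^{i+1}(-,A)$ exact; and $\mathbb{E}^i(f,-)=0$, $\mathbb{E}^i(-,g)=0$ for all $i\geq1$, $f\in\mathcal{P}_{1,\mathbb{E}}(\mathcal{C})$, $g\in\mathcal{I}_{1,\mathbb{E}}(\mathcal{C})$. Every small extriangulated category has such a family; one is fixed. $\mathcal{X}\subseteq\mathcal{C}$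 is $(n+2)$-rigid if $\mathbb{E}^i(X,X')=0$ for all $X,X'\in\mathcal{X}$ and $1\leq i\leq n+1$. $\mathrm{free}(\mathcal{X})$ is the class of all finite coproducts of objects in $\mathcal{X}$ (including $0$, closed under isomorphism); $\mathrm{smd}(\mathcal{X})$ is the class of all direct summands of objects of $\mathcal{X}$. A finite $\mathcal{X}$-coresolution of $C$ of length $m\geq 0$ consists of objects $C=K_0,K_1,\dots,K_m$ and $X_0,\dots,X_m\in\mathcal{X}$, conflations $K_i\to X_i\to K_{i+1}$ for $0\leq i<m$, and an isomorphism $K_m\simeq X_m$. $\mathcal{X}_n^{\vee}$ is the class of objects having a finite $\mathcal{X}$-coresolution of length $\leq n$. For $\mathcal{Y}\subseteq\mathcal{C}$: $\mathcal{Y}$ has enough deflations from $\mathcal{X}$ if for every $C\in\mathcal{Y}$ there is a deflation $f:X\to C$ with $X\in\mathcal{X}$; it has enough $\mathbb{E}$-projective morphisms from $\mathcal{X}$ if $f$ can moreover be chosen in $\mathcal{P}_{1,\mathbb{E}}(\mathcal{C})$. $\mathcal{X}$ is precovering in $\mathcal{Y}$ if for every $M\in\mathcal{Y}$ there is a morphism $f:X\to M$ with $X\in\mathcal{X}$ such that every morphism $X'\to M$ with $X'\in\mathcal{X}$ factors through $f$. $\Omega(\mathcal{X})$ is the class of objects $Y$ admitting a conflation $Y\to P\to X$ with $P\in\mathcal{P}_{\mathbb{E}}(\mathcal{C})$ and $X\in\mathcal{X}$. $[\mathcal{X}]$ is the ideal of morphisms factoring through objects of $\mathcal{X}$; $\mathcal{Y}/[\mathcal{X}]$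 is the full subcategory of the quotient with objects those of $\mathcal{Y}$. $\mathrm{Proj}(\mathcal{Z})$ is the class of objects $P$ of a category $\mathcal{Z}$ such that every morphism $P\to Y$ lifts through every epimorphism $X\to Y$. Let $\mathcal{P}_1(\mathcal{X}_n^{\vee})$ be the ideal of all morphisms $f$ in $\mathcal{X}_n^{\vee}$ with $\mathbb{E}(f,-)=0$, and $\underline{\mathcal{X}_n^{\vee}}:=\mathcal{X}_n^{\vee}/\mathcal{P}_1(\mathcal{X}_n^{\vee})$. For a small $\mathbb{Z}$-category $\mathcal{Z}$, $\mathsf{Mod}\,\mathcal{Z}$ is the category of contravariant additive functors $\mathcal{Z}\to Ab$, and $\mathrm{fp}\,\mathcal{Z}$ its full subcategory of finitely presented objects. For $M\in\mathcal{X}_{n+1}^{\vee}$, $\underline{\mathbb{E}}(-,M)\in\mathsf{Mod}\,\underline{\mathcal{X}_n^{\vee}}$ is induced by $\mathbb{E}(-,M)|_{\mathcal{X}_n^{\vee}}$; the functor $\mathcal{X}_{n+1}^{\vee}\to\mathsf{Mod}\,\underline{\mathcal{X}_n^{\vee}}$, $M\mapsto\underline{\mathbb{E}}(-,M)$, has kernel $[\mathcal{X}]$, takes values in $\mathrm{fp}\,\underline{\mathcal{X}_n^{\vee}}$ and induces the fully faithful functor $\mathbb{F}$. $\mathcal{R}_{\mathcal{X}}^n$ is the full subcategory of $\mathsf{Mod}\,\underline{\mathcal{X}_n^{\vee}}$ of those $G$ for which there is an exact sequence $\underline{\mathcal{X}_n^{\vee}}(-,X_0)\to\underline{\mathcal{X}_n^{\vee}}(-,X_1)\to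 G\to0$ with $X_0\in\mathcal{X}$, $X_1\in\mathcal{X}_n^{\vee}$; it is additive and closed under extensions, and is an exact category (Quillen) via the short exact sequences of $\mathsf{Mod}\,\underline{\mathcal{X}_n^{\vee}}$ with all terms in it. $\varepsilon_{\mathbb{F}}$ is the class of pairs $A'\xrightarrow{i}A\xrightarrow{p}A''$ in $\mathcal{X}_{n+1}^{\vee}/[\mathcal{X}]$ such that $0\to\mathbb{F}(A')\to\mathbb{F}(A)\to\mathbb{F}(A'')\to0$ is exact in $\mathsf{Mod}\,\underline{\mathcal{X}_n^{\vee}}$. An additive category is weakly idempotent complete if every split epimorphism has a kernel, and Krull–Schmidt if every object is a finite coproduct of objects with local endomorphism ring. *)

(* Defs.v *)
From HB Require Import structures.
From mathcomp Require Import all_boot all_algebra.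
From mathcomp Require Import boolp.

Set Implicit Arguments.
Unset Strict Implicit.
Unset Printing Implicit Defensive.

Import GRing.Theory.
Local Open Scope ring_scope.
Local Open Scope quotient_scope.

#[local] Obligation Tactic := idtac.

Section ZmodMorphism.
Variables (U V : zmodType) (f : U -> V) (Hf : zmod_morphism f).

Lemma zmod_mor0 : f 0 = 0.
Proof. by rewrite -(subrr 0) Hf subrr. Qed.

Lemma zmod_morN x : f (- x) = - f x.
Proof. by rewrite -sub0r Hf zmod_mor0 sub0r. Qed.

Lemma zmod_morD x y : f (x + y) = f x + f y.
Proof. by rewrite -[y in LHS]opprK Hf zmod_morN opprK. Qed.

End ZmodMorphism.

(* The type of objects is a parameter rather than a field, so that the same
   (universe-monomorphic) structure serves both for small categories and for
   the large categories of modules over them.  The carriers of [zmodType] are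
   arbitrary types, since every type has classically a choice structure. *)
Record precat (ob : Type) := Precat {
  hom : ob -> ob -> zmodType;
  idm : forall A, hom A A;
  comp : forall A B D, hom B D -> hom A B -> hom A D;
  comp1m : forall A B (f : hom A B), comp (idm B) f = f;
  compm1 : forall A B (f : hom A B), comp f (idm A) = f;
  compmA : forall A B D T (h : hom D T) (g : hom B D) (f : hom A B),
    comp h (comp g f) = comp (comp h g) f;
  comp_zmodl : forall A B D (f : hom A B),
    zmod_morphism (fun g : hom B D => comp g f);
  comp_zmodr : forall A B D (g : hom B D),
    zmod_morphism (fun f : hom A B => comp g f)
}.
Arguments hom {ob} C A B : rename.
Arguments idm {ob} C A : rename.
Arguments comp {ob C A B D} g f : rename.
Notation "g \oc f" := (comp g f) (at level 40, left associativity).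

Section Categories.
Variables (ob : Type) (C : precat ob).

Definition is_inverse A B (f : hom C A B) (g : hom C B A) :=
  g \oc f = idm C A /\ f \oc g = idm C B.

Definition is_iso A B (f : hom C A B) := exists g, is_inverse f g.

Definition isomorphic A B := exists f : hom C A B, is_iso f.

Definition is_mono A B (f : hom C A B) :=
  forall T (g h : hom C T A), f \oc g = f \oc h -> g = h.

Definition is_epi A B (f : hom C A B) :=
  forall T (g h : hom C B T), g \oc f = h \oc f -> g = h.

Definition is_kernel A B D (p : hom C B D) (i : hom C A B) :=
  p \oc i = 0 /\
  forall T (g : hom C T B), p \oc g = 0 -> exists! h, i \oc h = g.

Definition is_cokernel A B D (i : hom C A B) (p : hom C B D) :=
  p \oc i = 0 /\
  forall T (g : hom C B T), g \oc i = 0 -> exists! h, h \oc p = g.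

Definition ker_coker_pair A B D (i : hom C A B) (p : hom C B D) :=
  is_kernel p i /\ is_cokernel i p.

Definition is_pushout A B A' B' (i : hom C A B) (f : hom C A A')
    (i' : hom C A' B') (f' : hom C B B') :=
  f' \oc i = i' \oc f /\
  forall T (g : hom C B T) (h : hom C A' T), g \oc i = h \oc f ->
    exists! k, k \oc f' = g /\ k \oc i' = h.

Definition is_pullback B D B' D' (p : hom C B D) (f : hom C D' D)
    (p' : hom C B' D') (f' : hom C B' B) :=
  p \oc f' = f \oc p' /\
  forall T (g : hom C T B) (h : hom C T D'), p \oc g = f \oc h ->
    exists! k, f' \oc k = g /\ p' \oc k = h.

Definition is_zero_object Z :=
  (forall T (f : hom C Z T), f = 0) /\ (forall T (f : hom C T Z), f = 0).

Record biprod (A B : ob) := Biprod {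
  bp_ob : ob;
  in1 : hom C A bp_ob;
  in2 : hom C B bp_ob;
  pr1 : hom C bp_ob A;
  pr2 : hom C bp_ob B;
  pr1_in1 : pr1 \oc in1 = idm C A;
  pr2_in2 : pr2 \oc in2 = idm C B;
  pr1_in2 : pr1 \oc in2 = 0;
  pr2_in1 : pr2 \oc in1 = 0;
  bp_sum : in1 \oc pr1 + in2 \oc pr2 = idm C bp_ob
}.

Definition is_additive :=
  (exists Z, is_zero_object Z) /\ forall A B, inhabited (biprod A B).

Definition is_coprod n (A : 'I_n -> ob) S (i : forall k, hom C (A k) S) :=
  forall T (f : forall k, hom C (A k) T), exists! h : hom C S T,
    forall k, h \oc i k = f k.

Definition free_class (X : ob -> Prop) : ob -> Prop := fun S =>
  exists (n : nat) (A : 'I_n -> ob) (i : forall k, hom C (A k) S),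
    (forall k, X (A k)) /\ is_coprod i.

Definition smd_class (X : ob -> Prop) : ob -> Prop := fun S =>
  exists (S' : ob) (b : biprod S S'), X (bp_ob b).

Definition precovering (X Y : ob -> Prop) :=
  forall M, Y M -> exists (A : ob) (f : hom C A M), X A /\
    forall A' (f' : hom C A' M), X A' -> exists g, f' = f \oc g.

(* The endomorphism ring of [A] is local: it is non-trivial and its non-units
   are closed under addition. *)
Definition has_local_end A :=
  idm C A <> 0 /\
  forall f g : hom C A A, is_iso (f + g) -> is_iso f \/ is_iso g.

Definition Krull_Schmidt := forall A, free_class has_local_end A.

Definition weakly_idempotent_complete :=
  forall A B (p : hom C A B), (exists s, p \oc s = idm C B) ->
    exists (K : ob) (i : hom C K A), is_kernel p i.

Definition is_proj P :=
  forall A B (p : hom C A B), is_epi p ->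
    forall g : hom C P B, exists h, g = p \oc h.

Definition is_abelian :=
  [/\ is_additive,
      forall A B (f : hom C A B), exists (K : ob) (i : hom C K A), is_kernel f i,
      forall A B (f : hom C A B), exists (K : ob) (p : hom C B K), is_cokernel f p,
      forall A B (f : hom C A B), is_mono f ->
        exists (D : ob) (p : hom C B D), is_kernel p f
    & forall A B (f : hom C A B), is_epi f ->
        exists (D : ob) (i : hom C D A), is_cokernel i f].

(* Exact categories in the sense of Quillen, in Keller's axiomatisation. *)
Definition seq_class := forall A B D, hom C A B -> hom C B D -> Prop.

Definition admissible_mono (eps : seq_class) A B (i : hom C A B) :=
  exists (D : ob) (p : hom C B D), eps _ _ _ i p.

Definition admissible_epi (eps : seq_class) B D (p : hom C B D) :=
  exists (A : ob) (i : hom C A B), eps _ _ _ i p.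

Record is_exact_category (eps : seq_class) : Prop := {
  exc_additive : is_additive;
  exc_pair : forall A B D (i : hom C A B) (p : hom C B D),
    eps _ _ _ i p -> ker_coker_pair i p;
  exc_iso : forall A B D (i : hom C A B) (p : hom C B D)
      A' B' D' (i' : hom C A' B') (p' : hom C B' D')
      (a : hom C A A') (b : hom C B B') (d : hom C D D'),
    is_iso a -> is_iso b -> is_iso d ->
    b \oc i = i' \oc a -> d \oc p = p' \oc b ->
    eps _ _ _ i p -> eps _ _ _ i' p';
  exc_mono1 : forall A, admissible_mono eps (idm C A);
  exc_epi1 : forall A, admissible_epi eps (idm C A);
  exc_mono_comp : forall A B D (f : hom C A B) (g : hom C B D),
    admissible_mono eps f -> admissible_mono eps g ->
    admissible_mono eps (g \oc f);
  exc_epi_comp : forall A B D (f : hom C A B) (g : hom C B D),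
    admissible_epi eps f -> admissible_epi eps g ->
    admissible_epi eps (g \oc f);
  exc_pushout : forall A B A' (i : hom C A B) (f : hom C A A'),
    admissible_mono eps i ->
    exists (B' : ob) (i' : hom C A' B') (f' : hom C B B'),
      is_pushout i f i' f' /\ admissible_mono eps i';
  exc_pullback : forall B D D' (p : hom C B D) (f : hom C D' D),
    admissible_epi eps p ->
    exists (B' : ob) (p' : hom C B' D') (f' : hom C B' B),
      is_pullback p f p' f' /\ admissible_epi eps p'
}.

(* The exact category is abelian: its conflations are all short exact
   sequences of an abelian category. *)
Definition is_abelian_exact_category (eps : seq_class) :=
  [/\ is_exact_category eps, is_abelian
    & forall A B D (i : hom C A B) (p : hom C B D),
        eps _ _ _ i p <-> ker_coker_pair i p].

Program Definition fullsub (P : ob -> Prop) : precat {A | P A} :=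
  {| hom A B := hom C (sval A) (sval B);
     idm A := idm C (sval A);
     comp A B D g f := g \oc f |}.
Next Obligation. by move=> P A B f; apply: comp1m. Qed.
Next Obligation. by move=> P A B f; apply: compm1. Qed.
Next Obligation. by move=> P A B D T h g f; apply: compmA. Qed.
Next Obligation. by move=> P A B D f; apply: comp_zmodl. Qed.
Next Obligation. by move=> P A B D g; apply: comp_zmodr. Qed.

Record ideal := Ideal {
  idl : forall A B, hom C A B -> Prop;
  idl0 : forall A B, idl (0 : hom C A B);
  idlB : forall A B (f g : hom C A B), idl f -> idl g -> idl (f - g);
  idl_compl : forall A B D (f : hom C A B) (g : hom C B D),
    idl f -> idl (g \oc f);
  idl_compr : forall A B D (f : hom C A B) (g : hom C B D),
    idl g -> idl (g \oc f)
}.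

End Categories.

Arguments seq_class {ob} C.
Arguments idl {ob C} I {A B} f : rename.

Section Quotient.
Variables (ob : Type) (C : precat ob) (I : ideal C).

Definition idl_pred A B : {pred hom C A B} := fun f => `[< idl I f >].

Lemma idl_pred_closed A B : zmod_closed (@idl_pred A B).
Proof.
split=> [|f g]; rewrite ?inE /idl_pred; first exact/asboolP/idl0.
by move=> /asboolP If /asboolP Ig; apply/asboolP/idlB.
Qed.

HB.instance Definition _ A B :=
  GRing.isZmodClosed.Build _ (@idl_pred A B) (@idl_pred_closed A B).

Definition quot_hom (A B : ob) : zmodType := {ideal_quot (@idl_pred A B)}.

Definition qpi A B (f : hom C A B) : quot_hom A B := \pi_{ideal_quot (@idl_pred A B)} f.

Lemma qpi_eq A B (f g : hom C A B) : qpi f = qpi g <-> idl I (f - g).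
Proof.
rewrite /qpi; split=> [/eqP|].
  by rewrite -Quotient.idealrBE => /asboolP.
by move=> h; apply/eqP; rewrite -Quotient.idealrBE; apply/asboolP.
Qed.

Lemma qpi_repr A B (x : quot_hom A B) : qpi (repr x) = x.
Proof. exact: reprK. Qed.

Lemma repr_qpi A B (f : hom C A B) : idl I (repr (qpi f) - f).
Proof. by apply/qpi_eq; rewrite qpi_repr. Qed.

Lemma qpiB A B : zmod_morphism (@qpi A B).
Proof. by move=> f g; rewrite /qpi !piE. Qed.

Lemma qpi_comp A B D (g g' : hom C B D) (f f' : hom C A B) :
  qpi g = qpi g' -> qpi f = qpi f' -> qpi (g \oc f) = qpi (g' \oc f').
Proof.
move=> /qpi_eq hg /qpi_eq hf; apply: (@eq_trans _ _ (qpi (g' \oc f))).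
  by apply/qpi_eq; rewrite -(comp_zmodl f); apply: idl_compr.
by apply/qpi_eq; rewrite -(comp_zmodr g'); apply: idl_compl.
Qed.

Program Definition quotcat : precat ob :=
  {| hom := quot_hom;
     idm A := qpi (idm C A);
     comp A B D g f := qpi (repr g \oc repr f) |}.
Next Obligation.
move=> A B f; rewrite -[RHS]qpi_repr -[in RHS](comp1m (repr f)).
by apply: qpi_comp; rewrite ?qpi_repr.
Qed.
Next Obligation.
move=> A B f; rewrite -[RHS]qpi_repr -[in RHS](compm1 (repr f)).
by apply: qpi_comp; rewrite ?qpi_repr.
Qed.
Next Obligation.
move=> A B D T h g f /=.
apply: (@eq_trans _ _ (qpi (repr h \oc (repr g \oc repr f)))).
  by apply: qpi_comp; rewrite ?qpi_repr.
by rewrite compmA; apply: qpi_comp; rewrite ?qpi_repr.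
Qed.
Next Obligation.
move=> A B D f g h /=; rewrite -qpiB -(comp_zmodl (repr f)).
by apply: qpi_comp => //; rewrite qpiB !qpi_repr.
Qed.
Next Obligation.
move=> A B D g f h /=; rewrite -qpiB -(comp_zmodr (repr g)).
by apply: qpi_comp => //; rewrite qpiB !qpi_repr.
Qed.

Program Definition ideal_sub (P : ob -> Prop) : ideal (fullsub C P) :=
  {| idl A B f := idl I (f : hom C (sval A) (sval B)) |}.
Next Obligation. by move=> P A B; apply: idl0. Qed.
Next Obligation. by move=> P A B f g; apply: idlB. Qed.
Next Obligation. by move=> P A B D f g; apply: idl_compl. Qed.
Next Obligation. by move=> P A B D f g; apply: idl_compr. Qed.

End Quotient.

Record functor (ob1 ob2 : Type) (C : precat ob1) (D : precat ob2) := Functor {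
  fob :> ob1 -> ob2;
  fmap : forall A B, hom C A B -> hom D (fob A) (fob B);
  fmap_zmod : forall A B, zmod_morphism (@fmap A B);
  fmap1 : forall A, fmap (idm C A) = idm D (fob A);
  fmap_comp : forall A B E (g : hom C B E) (f : hom C A B),
    fmap (g \oc f) = fmap g \oc fmap f
}.
Arguments fmap {ob1 ob2 C D} F {A B} f : rename.

Section Functors.
Variables (ob1 ob2 : Type) (C : precat ob1) (D : precat ob2).

Definition fully_faithful (F : functor C D) :=
  forall A B (g : hom D (F A) (F B)), exists! f : hom C A B, fmap F f = g.

Definition quasi_inverse (F : functor C D) (G : functor D C) :=
  (exists eta : forall A, hom C A (G (F A)),
     (forall A, is_iso (eta A)) /\
     forall A B (f : hom C A B), fmap G (fmap F f) \oc eta A = eta B \oc f) /\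
  (exists theta : forall A, hom D (F (G A)) A,
     (forall A, is_iso (theta A)) /\
     forall A B (f : hom D A B),
       f \oc theta A = theta B \oc fmap F (fmap G f)).

Definition is_equivalence (F : functor C D) :=
  exists G : functor D C, quasi_inverse F G.

End Functors.

Definition is_exact_functor ob1 ob2 (C : precat ob1) (D : precat ob2)
    (F : functor C D) (eps : seq_class C) (eps' : seq_class D) :=
  forall A B T (i : hom C A B) (p : hom C B T),
    eps _ _ _ i p -> eps' _ _ _ (fmap F i) (fmap F p).

Definition is_exact_equivalence ob1 ob2 (C : precat ob1) (D : precat ob2)
    (F : functor C D) (eps : seq_class C) (eps' : seq_class D) :=
  exists G : functor D C,
    [/\ quasi_inverse F G, is_exact_functor F eps eps'
      & is_exact_functor G eps' eps].

Section Restrict.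
Variables (ob1 ob2 : Type) (C : precat ob1) (D : precat ob2) (F : functor C D).

Program Definition restrict (P : ob1 -> Prop) : functor (fullsub C P) D :=
  {| fob A := F (sval A); fmap A B f := fmap F f |}.
Next Obligation. by move=> P A B f g; apply: fmap_zmod. Qed.
Next Obligation. by move=> P A; apply: fmap1. Qed.
Next Obligation. by move=> P A B E g f; apply: fmap_comp. Qed.

Program Definition corestrict (Q : ob2 -> Prop) (HQ : forall A, Q (F A)) :
    functor C (fullsub D Q) :=
  {| fob A := exist _ (F A) (HQ A); fmap A B f := fmap F f |}.
Next Obligation. by move=> Q HQ A B f g; apply: fmap_zmod. Qed.
Next Obligation. by move=> Q HQ A; apply: fmap1. Qed.
Next Obligation. by move=> Q HQ A B E g f; apply: fmap_comp. Qed.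

End Restrict.

Record modl (ob : Type) (Z : precat ob) := Modl {
  mo :> ob -> zmodType;
  mmap : forall A B, hom Z A B -> mo B -> mo A;
  mmap_zmod : forall A B (f : hom Z A B), zmod_morphism (mmap f);
  mmap_zmodl : forall A B (u : mo B),
    zmod_morphism (fun f : hom Z A B => mmap f u);
  mmap1 : forall A (u : mo A), mmap (idm Z A) u = u;
  mmap_comp : forall A B D (g : hom Z B D) (f : hom Z A B) u,
    mmap (g \oc f) u = mmap f (mmap g u)
}.
Arguments mmap {ob Z} G {A B} f u : rename.

Record nattrans (ob : Type) (Z : precat ob) (G H : modl Z) := NatTrans {
  nt :> forall A, G A -> H A;
  nt_zmod : forall A, zmod_morphism (nt (A := A));
  nt_nat : forall A B (f : hom Z A B) u, nt (mmap G f u) = mmap H f (nt u)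
}.

Section Modules.
Variables (ob : Type) (Z : precat ob).
Implicit Types G H K : modl Z.

Lemma nattransP G H (s t : nattrans G H) : (forall A u, s A u = t A u) -> s = t.
Proof.
case: s t => [s s1 s2] [t t1 t2] /= st.
have {}st : s = t.
  by apply: functional_extensionality_dep => A; apply/funext => u; apply: st.
by subst t; congr NatTrans; apply: Prop_irrelevance.
Qed.

HB.instance Definition _ G H := gen_eqMixin (nattrans G H).
HB.instance Definition _ G H := gen_choiceMixin (nattrans G H).

Program Definition nt0 G H : nattrans G H := {| nt A u := 0 |}.
Next Obligation. by move=> G H A u v; rewrite subr0. Qed.
Next Obligation.
by move=> G H A B f u; rewrite (zmod_mor0 (mmap_zmod f)).
Qed.

Program Definition ntD G H (s t : nattrans G H) : nattrans G H :=
  {| nt A u := s A u + t A u |}.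
Next Obligation.
by move=> G H s t A u v /=; rewrite (nt_zmod s) (nt_zmod t) addrACA opprD.
Qed.
Next Obligation.
by move=> G H s t A B f u /=; rewrite !nt_nat (zmod_morD (mmap_zmod f)).
Qed.

Program Definition ntN G H (s : nattrans G H) : nattrans G H :=
  {| nt A u := - s A u |}.
Next Obligation. by move=> G H s A u v; rewrite (nt_zmod s) opprD. Qed.
Next Obligation.
by move=> G H s A B f u /=; rewrite nt_nat (zmod_morN (mmap_zmod f)).
Qed.

Lemma ntDA G H : associative (@ntD G H).
Proof. by move=> s t r; apply: nattransP => A u /=; rewrite addrA. Qed.

Lemma ntDC G H : commutative (@ntD G H).
Proof. by move=> s t; apply: nattransP => A u /=; rewrite addrC. Qed.

Lemma nt0D G H : left_id (nt0 G H) (@ntD G H).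
Proof. by move=> s; apply: nattransP => A u /=; rewrite add0r. Qed.

Lemma ntND G H : left_inverse (nt0 G H) (@ntN G H) (@ntD G H).
Proof. by move=> s; apply: nattransP => A u /=; rewrite addNr. Qed.

HB.instance Definition _ G H := GRing.isZmodule.Build (nattrans G H)
  (@ntDA G H) (@ntDC G H) (@nt0D G H) (@ntND G H).

Program Definition nt1 G : nattrans G G := {| nt A u := u |}.
Next Obligation. by []. Qed.
Next Obligation. by []. Qed.

Program Definition ntcomp G H K (t : nattrans H K) (s : nattrans G H) :
  nattrans G K := {| nt A u := t A (s A u) |}.
Next Obligation. by move=> G H K t s A u v /=; rewrite (nt_zmod s) (nt_zmod t). Qed.
Next Obligation. by move=> G H K t s A B f u /=; rewrite !nt_nat. Qed.

Program Definition modcat : precat (modl Z) :=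
  {| hom G H := nattrans G H; idm G := nt1 G; comp G H K t s := ntcomp t s |}.
Next Obligation. by move=> G H s; apply: nattransP. Qed.
Next Obligation. by move=> G H s; apply: nattransP. Qed.
Next Obligation. by move=> G H K L r t s; apply: nattransP. Qed.
Next Obligation. by move=> G H K s t r; apply: nattransP. Qed.
Next Obligation.
by move=> G H K s t r; apply: nattransP => A u /=; rewrite (nt_zmod s).
Qed.

Program Definition yoneda (T : ob) : modl Z :=
  {| mo A := hom Z A T; mmap A B f u := u \oc f |}.
Next Obligation. by move=> T A B f; apply: comp_zmodl. Qed.
Next Obligation. by move=> T A B u; apply: comp_zmodr. Qed.
Next Obligation. by move=> T A u; apply: compm1. Qed.
Next Obligation. by move=> T A B D g f u; apply: compmA. Qed.

(* Exactness in the category of modules is computed pointwise. *)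
Definition mod_exact G H K (s : nattrans G H) (t : nattrans H K) :=
  forall A (u : H A), t A u = 0 <-> exists v, u = s A v.

Definition mod_epi G H (s : nattrans G H) :=
  forall A (u : H A), exists v, u = s A v.

Definition mod_mono G H (s : nattrans G H) :=
  forall A (u : G A), s A u = 0 -> u = 0.

Definition mod_short_exact : seq_class modcat :=
  fun G H K (s : nattrans G H) (t : nattrans H K) =>
    [/\ mod_mono s, mod_exact s t & mod_epi t].

(* [Z] need not be additive here, whence the finite coproducts of
   representable functors. *)
Definition finitely_presented (G : modl Z) : Prop :=
  exists (P1 P0 : modl Z) (s : nattrans P1 P0) (t : nattrans P0 G),
    [/\ free_class modcat (fun P => exists T, P = yoneda T) P1,
        free_class modcat (fun P => exists T, P = yoneda T) P0,
        mod_exact s t & mod_epi t].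

End Modules.

Record bifunctor (ob : Type) (C : precat ob) := Bifunctor {
  bif :> ob -> ob -> zmodType;
  pull : forall A B B', hom C B' B -> bif B A -> bif B' A;
  push : forall B A A', hom C A A' -> bif B A -> bif B A';
  pull_zmod : forall A B B' (c : hom C B' B), zmod_morphism (@pull A B B' c);
  push_zmod : forall B A A' (a : hom C A A'), zmod_morphism (@push B A A' a);
  pull_zmodl : forall A B B' (u : bif B A),
    zmod_morphism (fun c : hom C B' B => pull c u);
  push_zmodl : forall B A A' (u : bif B A),
    zmod_morphism (fun a : hom C A A' => push a u);
  pull1 : forall A B (u : bif B A), pull (idm C B) u = u;
  push1 : forall A B (u : bif B A), push (idm C A) u = u;
  pull_comp : forall A B B' B'' (c : hom C B' B) (c' : hom C B'' B')
    (u : bif B A), pull (c \oc c') u = pull c' (pull c u);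
  push_comp : forall B A A' A'' (a' : hom C A' A'') (a : hom C A A')
    (u : bif B A), push (a' \oc a) u = push a' (push a u);
  pull_push : forall A A' B B' (c : hom C B' B) (a : hom C A A') (u : bif B A),
    pull c (push a u) = push a (pull c u)
}.
Arguments pull {ob C E A B B'} c u : rename.
Arguments push {ob C E B A A'} a u : rename.

Section Extriangulated.
Variables (ob : Type) (C : precat ob) (E : bifunctor C).

(* [s d x y] means that the sequence [A -x-> B -y-> D] lies in the class that the
   realization assigns to [d : E D A]. *)
Definition realization :=
  forall A B D, E D A -> hom C A B -> hom C B D -> Prop.

Definition seq_equiv A B B' D (x : hom C A B) (y : hom C B D)
    (x' : hom C A B') (y' : hom C B' D) :=
  exists b : hom C B B', [/\ is_iso b, b \oc x = x' & y' \oc b = y].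

Variable s : realization.
Arguments s {A B D}.

Record is_additive_realization : Prop := {
  real_ex : forall A D (d : E D A),
    exists (B : ob) (x : hom C A B) (y : hom C B D), s d x y;
  real_class : forall A B B' D (d : E D A) (x : hom C A B) (y : hom C B D)
      (x' : hom C A B') (y' : hom C B' D),
    s d x y -> (s d x' y' <-> seq_equiv x y x' y');
  real_mor : forall A B D A' B' D' (d : E D A) (d' : E D' A')
      (x : hom C A B) (y : hom C B D) (x' : hom C A' B') (y' : hom C B' D')
      (a : hom C A A') (c : hom C D D'),
    s d x y -> s d' x' y' -> push a d = pull c d' ->
    exists b : hom C B B', b \oc x = x' \oc a /\ y' \oc b = c \oc y;
  real_0 : forall A D (b : biprod C A D),
    s (0 : E D A) (in1 b) (pr2 b);
  real_sum : forall A B D A' B' D' (d : E D A) (d' : E D' A')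
      (x : hom C A B) (y : hom C B D) (x' : hom C A' B') (y' : hom C B' D')
      (bA : biprod C A A') (bB : biprod C B B') (bD : biprod C D D'),
    s d x y -> s d' x' y' ->
    s (push (in1 bA) (pull (pr1 bD) d) + push (in2 bA) (pull (pr2 bD) d'))
      (in1 bB \oc x \oc pr1 bA + in2 bB \oc x' \oc pr2 bA)
      (in1 bD \oc y \oc pr1 bB + in2 bD \oc y' \oc pr2 bB)
}.

Definition ET3 :=
  forall A B D A' B' D' (d : E D A) (d' : E D' A')
    (x : hom C A B) (y : hom C B D) (x' : hom C A' B') (y' : hom C B' D')
    (a : hom C A A') (b : hom C B B'),
  s d x y -> s d' x' y' -> b \oc x = x' \oc a ->
  exists c : hom C D D', c \oc y = y' \oc b /\ push a d = pull c d'.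

Definition ET3op :=
  forall A B D A' B' D' (d : E D A) (d' : E D' A')
    (x : hom C A B) (y : hom C B D) (x' : hom C A' B') (y' : hom C B' D')
    (b : hom C B B') (c : hom C D D'),
  s d x y -> s d' x' y' -> c \oc y = y' \oc b ->
  exists a : hom C A A', b \oc x = x' \oc a /\ push a d = pull c d'.

(* The diagram of (ET4):
     A -f-> B -f'-> D
     |      |g      |u
     A -h-> G -h'-> T
            |g'     |v
            F ----- F      *)
Definition ET4 :=
  forall A B D G F (d : E D A) (d' : E F B)
    (f : hom C A B) (f' : hom C B D) (g : hom C B G) (g' : hom C G F),
  s d f f' -> s d' g g' ->
  exists (T : ob) (d'' : E T A) (h : hom C A G) (h' : hom C G T)
    (u : hom C D T) (v : hom C T F),
  [/\ s d'' h h', [/\ h = g \oc f, h' \oc g = u \oc f' & v \oc h' = g'],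
      s (push f' d') u v, pull u d'' = d & push f d'' = pull v d'].

(* The diagram of (ET4)^op:
     F ----- F
     |v      |g'
     T -h'-> G -h-> B
     |u      |g     |
     D -f'-> A -f-> B      *)
Definition ET4op :=
  forall A B D G F (d : E B D) (d' : E A F)
    (f' : hom C D A) (f : hom C A B) (g' : hom C F G) (g : hom C G A),
  s d f' f -> s d' g' g ->
  exists (T : ob) (d'' : E B T) (h' : hom C T G) (h : hom C G B)
    (v : hom C F T) (u : hom C T D),
  [/\ s d'' h' h, [/\ h = f \oc g, g \oc h' = f' \oc u & h' \oc v = g'],
      s (pull f' d') v u, push u d'' = d & pull f d'' = push v d'].

End Extriangulated.

Record extri (ob : Type) := Extri {
  ecat :> precat ob;
  ecat_additive : is_additive ecat;
  Ext : bifunctor ecat;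
  real : realization Ext;
  real_additive : is_additive_realization real;
  real_ET3 : ET3 real;
  real_ET3op : ET3op real;
  real_ET4 : ET4 real;
  real_ET4op : ET4op real
}.
Arguments Ext {ob} C : rename.
Arguments real {ob C A B D} d x y : rename.

Section ExtriDefs.
Variables (ob : Type) (C : extri ob).
Implicit Types X Y : ob -> Prop.

Definition conflation A B D (x : hom C A B) (y : hom C B D) :=
  exists d : Ext C D A, real d x y.

Definition deflation B D (y : hom C B D) :=
  exists (A : ob) (x : hom C A B), conflation x y.

Definition Eproj_mor A B (f : hom C A B) :=
  forall T (u : Ext C B T), pull f u = 0.

Definition Einj_mor A B (f : hom C A B) :=
  forall T (u : Ext C T A), push f u = 0.

Definition Eproj P :=
  forall B D (y : hom C B D), deflation y ->
    forall g : hom C P D, exists h, g = y \oc h.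

Definition enough_Eproj :=
  forall D, exists (P : ob) (y : hom C P D), Eproj P /\ deflation y.

Definition enough_deflations Y X :=
  forall D, Y D -> exists (A : ob) (f : hom C A D), X A /\ deflation f.

Definition enough_Eproj_mor Y X :=
  forall D, Y D -> exists (A : ob) (f : hom C A D),
    [/\ X A, deflation f & Eproj_mor f].

Inductive coresolution X : nat -> ob -> Prop :=
| coresolution_0 K A : X A -> isomorphic C K A -> coresolution X 0 K
| coresolution_S m K A K' (x : hom C K A) (y : hom C A K') :
    X A -> conflation x y -> coresolution X m K' -> coresolution X m.+1 K.

(* The class X_n^\vee. *)
Definition vee X (n : nat) : ob -> Prop := fun K =>
  exists m, (m <= n)%N /\ coresolution X m K.

Definition Omega X : ob -> Prop := fun K =>
  exists (P A : ob) (x : hom C K P) (y : hom C P A),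
    [/\ Eproj P, X A & conflation x y].

(* Indices are shifted: [Epow t i] is the bifunctor E^{i+1} of the family
   E^1 = E, E^2 = t 0, E^3 = t 1, ... *)
Definition Epow (t : nat -> bifunctor C) (i : nat) : bifunctor C :=
  if i is j.+1 then t j else Ext C.

Record higher_ext := HigherExt {
  etail : nat -> bifunctor C;
  (* the transformations E^{i+1}(A,-) -> E^{i+2}(D,-) and
     E^{i+1}(-,D) -> E^{i+2}(-,A) *)
  econ : forall (i : nat) A B D (d : Ext C D A) (x : hom C A B) (y : hom C B D),
    real d x y -> forall T, Epow etail i A T -> Epow etail i.+1 D T;
  ecov : forall (i : nat) A B D (d : Ext C D A) (x : hom C A B) (y : hom C B D),
    real d x y -> forall T, Epow etail i T D -> Epow etail i.+1 T A;
  econ_zmod : forall i A B D d x y r T, zmod_morphism (@econ i A B D d x y r T);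
  ecov_zmod : forall i A B D d x y r T, zmod_morphism (@ecov i A B D d x y r T);
  econ_nat : forall i A B D d x y r T T' (t : hom C T T') u,
    @econ i A B D d x y r T' (push t u) = push t (econ r u);
  ecov_nat : forall i A B D d x y r T T' (t : hom C T' T) u,
    @ecov i A B D d x y r T' (pull t u) = pull t (ecov r u);
  econ_mor : forall i A B D d x y r A' B' D' d' x' y' r'
      (a : hom C A A') (b : hom C B B') (c : hom C D D'),
    b \oc x = x' \oc a -> y' \oc b = c \oc y -> push a d = pull c d' ->
    forall T (u : Epow etail i A' T),
      @econ i A B D d x y r T (pull a u) =
      pull c (@econ i A' B' D' d' x' y' r' T u);
  ecov_mor : forall i A B D d x y r A' B' D' d' x' y' r'
      (a : hom C A A') (b : hom C B B') (c : hom C D D'),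
    b \oc x = x' \oc a -> y' \oc b = c \oc y -> push a d = pull c d' ->
    forall T (u : Epow etail i T D),
      @ecov i A' B' D' d' x' y' r' T (push c u) =
      push a (@ecov i A B D d x y r T u);
  econ_ex1 : forall i A B D (d : Ext C D A) (x : hom C A B) (y : hom C B D),
    real d x y -> forall T (u : Epow etail i B T),
      pull x u = 0 <-> exists v, u = pull y v;
  econ_ex2 : forall i A B D d x y r T (u : Epow etail i A T),
      @econ i A B D d x y r T u = 0 <-> exists v, u = pull x v;
  ecov_ex1 : forall i A B D (d : Ext C D A) (x : hom C A B) (y : hom C B D),
    real d x y -> forall T (u : Epow etail i T B),
      push y u = 0 <-> exists v, u = push x v;
  ecov_ex2 : forall i A B D d x y r T (u : Epow etail i T D),
      @ecov i A B D d x y r T u = 0 <-> exists v, u = push y v;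
  epow_proj : forall i A B (f : hom C A B), Eproj_mor f ->
    forall T (u : Epow etail i B T), pull f u = 0;
  epow_inj : forall i A B (f : hom C A B), Einj_mor f ->
    forall T (u : Epow etail i T A), push f u = 0
}.

(* [X] is m-rigid: E^j(X,X) = 0 for 1 <= j <= m - 1, where j = i + 1. *)
Definition rigid (H : higher_ext) (m : nat) X :=
  forall i, (i.+1 < m)%N -> forall A A', X A -> X A' ->
    forall u : Epow (etail H) i A A', u = 0.

End ExtriDefs.

Section Ideals.
Variables (ob : Type) (C : extri ob).

Program Definition Eproj_ideal : ideal C := {| idl A B f := Eproj_mor f |}.
Next Obligation.
by move=> A B T u; rewrite (zmod_mor0 (pull_zmodl u)).
Qed.
Next Obligation.
by move=> A B f g hf hg T u; rewrite (pull_zmodl u) hf hg subrr.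
Qed.
Next Obligation.
by move=> A B D f g hf T u; rewrite pull_comp hf.
Qed.
Next Obligation.
by move=> A B D f g hg T u; rewrite pull_comp hg (zmod_mor0 (pull_zmod f)).
Qed.

Variables (X : ob -> Prop) (HX : forall S, X S <-> free_class C X S).

Definition factors A B (f : hom C A B) :=
  exists (K : ob) (g : hom C K B) (h : hom C A K), X K /\ f = g \oc h.

Lemma free_biprod A B (b : biprod C A B) : X A -> X B -> X (bp_ob b).
Proof.
move=> XA XB; apply/HX.
exists 2%N, (fun k : 'I_2 => if val k == 0%N then A else B).
exists (fun k : 'I_2 => match val k == 0%N as c return
  hom C (if c then A else B) (bp_ob b) with true => in1 b | false => in2 b end).
split=> [k|T f]; first by case: ifP.
pose f0 : hom C A T := f ord0; pose f1 : hom C B T := f ord_max.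
exists (f0 \oc pr1 b + f1 \oc pr2 b); split=> [k|h hk].
  case: k => [[|[|//]] hk] /=; rewrite (zmod_morD (comp_zmodl _)) -!compmA.
    by rewrite pr1_in1 pr2_in1 (zmod_mor0 (comp_zmodr _)) compm1 addr0 (bool_irrelevance hk (ltn0Sn 1)).
  by rewrite pr1_in2 pr2_in2 (zmod_mor0 (comp_zmodr _)) compm1 add0r (bool_irrelevance hk (ltnSn 1)).
have h0 : h \oc in1 b = f0 := hk ord0.
have h1 : h \oc in2 b = f1 := hk ord_max.
by rewrite -h0 -h1 -!compmA -(zmod_morD (comp_zmodr h)) bp_sum compm1.
Qed.

Program Definition factor_ideal : ideal C := {| idl := factors |}.
Next Obligation.
move=> A B; have [[Z [Z1 Z2]] _] := ecat_additive C.
exists Z, 0, 0; split; last by rewrite (zmod_mor0 (comp_zmodl _)).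
apply/HX; exists 0%N, (fun=> Z), (fun=> idm C Z); split=> [[]//|T f].
by exists 0; split=> [[]//|h _]; rewrite (Z1 _ h).
Qed.
Next Obligation.
move=> A B f f' [K [g [h [XK ->]]]] [K' [g' [h' [XK' ->]]]].
have [_ /(_ K K') [b]] := ecat_additive C.
exists (bp_ob b), (g \oc pr1 b - g' \oc pr2 b), (in1 b \oc h - in2 b \oc (- h')).
split; first exact: free_biprod.
rewrite (comp_zmodl _) !(comp_zmodr _) !(zmod_morN (comp_zmodr _)) !opprK.
rewrite -!compmA !(compmA (pr1 b)) !(compmA (pr2 b)).
rewrite pr1_in1 pr1_in2 pr2_in1 pr2_in2 !comp1m.
by rewrite !(zmod_mor0 (comp_zmodl _)) !(zmod_mor0 (comp_zmodr _)) addr0 add0r.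
Qed.
Next Obligation.
move=> A B D f g [K [p [h [XK ->]]]]; exists K, (g \oc p), h.
by split=> //; rewrite compmA.
Qed.
Next Obligation.
move=> A B D f g [K [p [h [XK ->]]]]; exists K, p, (h \oc f).
by split=> //; rewrite compmA.
Qed.

End Ideals.

Section FunctorF.
Variables (ob : Type) (C : extri ob) (X : ob -> Prop) (n : nat).

(* X_n^\vee / P_1(X_n^\vee) *)
Definition stable : precat {K | vee C X n K} :=
  quotcat (ideal_sub (Eproj_ideal C) (vee C X n)).

Lemma pull_stable (K L : {K | vee C X n K}) (f g : hom C (sval K) (sval L))
    M (u : Ext C (sval L) M) :
  Eproj_mor (f - g) -> pull f u = pull g u.
Proof. by move=> /(_ M u); rewrite (pull_zmodl u) => /subr0_eq. Qed.

(* The value of E(-,M) on a class of morphisms is computed on any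
   representative. *)
Program Definition Emod (M : ob) : modl stable :=
  {| mo K := Ext C (sval K) M;
     mmap K L (f : hom stable K L) u :=
       pull (repr f : hom C (sval K) (sval L)) u |}.
Next Obligation. by move=> M K L f; apply: pull_zmod. Qed.
Next Obligation.
move=> M K L u f g /=; rewrite -(pull_zmodl u); apply: pull_stable.
rewrite -[f in repr (f - g)](@qpi_repr _ _ _ K L).
rewrite -[g in repr (_ - g)](@qpi_repr _ _ _ K L) -(@qpiB _ _ _ K L).
exact: (repr_qpi (ideal_sub (Eproj_ideal C) (vee C X n))).
Qed.
Next Obligation.
move=> M K u /=; rewrite -[RHS]pull1; apply: pull_stable.
exact: (repr_qpi (ideal_sub (Eproj_ideal C) (vee C X n))).
Qed.
Next Obligation.
move=> M K L N g f u /=; rewrite -pull_comp; apply: pull_stable.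
exact: (repr_qpi (ideal_sub (Eproj_ideal C) (vee C X n))).
Qed.

(* The class R_X^n. *)
Definition inR (G : modl stable) : Prop :=
  exists (K0 K1 : {K | vee C X n K})
    (a : nattrans (yoneda stable K0) (yoneda stable K1))
    (b : nattrans (yoneda stable K1) G),
  [/\ X (sval K0), mod_exact a b & mod_epi b].

Variables (HX : forall S, X S <-> free_class C X S).
Variables (H : higher_ext C) (Hrig : rigid H n.+2 X).

Lemma Epow_vee m K T : coresolution C X m K -> X T ->
  forall i, (i + m <= n)%N -> forall u : Epow (etail H) i K T, u = 0.
Proof.
move=> cK XT; elim: cK => [{}K A XA [f [g [gf _]]]|{}m {}K A K' x y XA [d r] _ IH]
  i lein u.
  rewrite -(pull1 u) -gf pull_comp (Hrig _ XA XT (pull g u)) ?ltnS ?(leq_trans _ lein) ?leq_addr //.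
  exact: zmod_mor0 (pull_zmod _).
have /(econ_ex2 r) [v ->] : econ r u = 0 by apply: IH; rewrite addSnnS.
rewrite (Hrig _ XA XT v); last by rewrite !ltnS (leq_trans _ lein) ?leq_addr.
exact: zmod_mor0 (pull_zmod _).
Qed.

Lemma Ext_vee K T (u : Ext C K T) : vee C X n K -> X T -> u = 0.
Proof.
by move=> [m [lemn cK]] XT; apply: (Epow_vee cK XT (i := 0%N)).
Qed.

Lemma push_factor (K : {K | vee C X n K}) M N (f g : hom C M N)
    (u : Ext C (sval K) M) :
  factors X (f - g) -> push f u = push g u.
Proof.
move=> [T [p [q [XT E]]]]; apply/eqP; rewrite -subr_eq0 -(push_zmodl u) E.
rewrite push_comp (Ext_vee (push q u) (svalP K) XT).
by rewrite (zmod_mor0 (push_zmod p)).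
Qed.

Program Definition Fnat M N (f : hom C M N) : nattrans (Emod M) (Emod N) :=
  {| nt K u := push f (u : Ext C (sval K) M) |}.
Next Obligation. by move=> M N f K u v /=; apply: push_zmod. Qed.
Next Obligation. by move=> M N f K L g u /=; rewrite pull_push. Qed.

Program Definition ext_functor : functor (quotcat (factor_ideal HX)) (modcat stable) :=
  {| fob M := Emod M;
     fmap M N (f : hom (quotcat (factor_ideal HX)) M N) := Fnat (repr f) |}.
Next Obligation.
move=> M N f g; apply: nattransP => K u /=.
rewrite -[RHS](push_zmodl (u : Ext C (sval K) M)); apply: push_factor.
rewrite -[f in repr (f - g)](@qpi_repr _ _ _ M N).
rewrite -[g in repr (_ - g)](@qpi_repr _ _ _ M N) -(@qpiB _ _ _ M N).
exact: (repr_qpi (factor_ideal HX)).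
Qed.
Next Obligation.
move=> M; apply: nattransP => K u /=; rewrite -[RHS](push1 (u : Ext C (sval K) M)).
by apply: push_factor; apply: (repr_qpi (factor_ideal HX)).
Qed.
Next Obligation.
move=> M N L g f; apply: nattransP => K u /=; rewrite -push_comp.
by apply: push_factor; apply: (repr_qpi (factor_ideal HX)).
Qed.

(* X_{n+1}^\vee / [X] *)
Definition vee_quot : precat {M | vee C X n.+1 M} :=
  fullsub (quotcat (factor_ideal HX)) (vee C X n.+1).

Definition functorF : functor vee_quot (modcat stable) := restrict ext_functor (vee C X n.+1).

Definition epsF : seq_class vee_quot := fun A B D i p =>
  mod_short_exact (fmap functorF i) (fmap functorF p).

Definition epsR : seq_class (fullsub (modcat stable) inR) := fun A B D i p =>
  @mod_short_exact _ stable (sval A) (sval B) (sval D) i p.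

End FunctorF.

Arguments epsF {ob C X n} HX {H} Hrig A B D i p : rename.
Arguments epsR {ob} C X n A B D i p : rename.

(* Main.v *)
From HB Require Import structures.
From mathcomp Require Import all_boot all_algebra.
From mathcomp Require Import boolp.
Require Import Defs.

(** Every [M] in [vee (n+1)] has a conflation [M -> A -> M'] with [A] in [X] and [M'] in
    [vee n]. By rigidity and dimension shifting, [E(K, A) = 0] for [K] in [vee n], so the
    long exact sequence turns the conflation into an exact sequence
    [Hom(-, A) -> Hom(-, M') -> E(-, M) -> 0] over the stable category: [E(-, M)] is generated
    by the extension of the conflation, with the deflation as its only relation
    ([Emod_pres]). Everything about the functor [F] is read off from this presentation.
    A natural transformation is determined by the image of the generator, which makes [F]
    fully faithful on the quotient by [X] ([F_ff]).
    Conversely, a relation [f : K0 -> K1] becomes a deflation once an [E]-projective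
    deflation [P -> K1] with [P] in [X] is added to it; the latter is zero in the stable
    category, so the cocone [M] of the sum satisfies [F M = coker f] ([F_surj]). The image of
    [F] is thus exactly the class of modules presented by a relation with source in [X].

    That class is closed under extensions by the horseshoe lemma ([presented_ext]). For a
    fully faithful functor into modules with extension-closed image, the sequences that
    become short exact form an exact structure, since the cokernels, kernels, pushouts and
    pullbacks that the axioms ask for are extensions of objects at hand ([preimage_exact]).
    If kernels and cokernels stay in the image too, then the structure is abelian
    ([preimage_abelian_exact]). When [vee n = X], all finitely presented modules are in the
    image. Stability under cokernels is formal; stability under kernels amounts to weak
    kernels in the stable category, and a weak kernel is a cover of the cocone
    of a relation completed to a deflation ([st_weak_kernels]).

    When [X] is closed under summands, so is [vee (n+1)] ([coresolution_summand]). A split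
    epimorphism of the quotient category is then represented by a split deflation of [C],
    whose cocone is its kernel, and decompositions into local objects descend from [C].

    Finally, if [K -> P -> T] is a conflation with [P] projective, then [F K] is the functor
    represented by [T], as [P -> T] is zero in the stable category ([Omega_yoneda]). Representable
    functors are projective and every [F M] is a quotient of one, hence the projective
    objects are the summands of syzygies. In the Krull-Schmidt case, a projective object with
    local endomorphism ring is a retract of a representable functor that decomposes into
    local or zero terms, so it is isomorphic to one of the terms ([local_proj_Omega]). *)

Set Implicit Arguments.
Unset Strict Implicit.
Unset Printing Implicit Defensive.

Import GRing.Theory.
Local Open Scope ring_scope.
#[local] Obligation Tactic := idtac.

(** * Preadditive categories *)
Section Preadditive.
Variables (ob : Type) (C : precat ob).

Lemma comp0m A B D (f : hom C A B) : (0 : hom C B D) \oc f = 0.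
Proof. exact: zmod_mor0 (comp_zmodl f). Qed.

Lemma compm0 A B D (g : hom C B D) : g \oc (0 : hom C A B) = 0.
Proof. exact: zmod_mor0 (comp_zmodr g). Qed.

Lemma compDl A B D (g h : hom C B D) (f : hom C A B) :
  (g + h) \oc f = g \oc f + h \oc f.
Proof. exact: zmod_morD (comp_zmodl f) _ _. Qed.

Lemma compDr A B D (g : hom C B D) (f h : hom C A B) :
  g \oc (f + h) = g \oc f + g \oc h.
Proof. exact: zmod_morD (comp_zmodr g) _ _. Qed.

Lemma compBl A B D (g h : hom C B D) (f : hom C A B) :
  (g - h) \oc f = g \oc f - h \oc f.
Proof. exact: (comp_zmodl f). Qed.

Lemma compBr A B D (g : hom C B D) (f h : hom C A B) :
  g \oc (f - h) = g \oc f - g \oc h.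
Proof. exact: (comp_zmodr g). Qed.

Lemma compNl A B D (g : hom C B D) (f : hom C A B) : (- g) \oc f = - (g \oc f).
Proof. exact: zmod_morN (comp_zmodl f) _. Qed.

Lemma compNr A B D (g : hom C B D) (f : hom C A B) : g \oc (- f) = - (g \oc f).
Proof. exact: zmod_morN (comp_zmodr g) _. Qed.

Lemma comp_suml n A B D (g : 'I_n -> hom C B D) (f : hom C A B) :
  (\sum_k g k) \oc f = \sum_k (g k \oc f).
Proof.
by apply: (big_morph (fun g : hom C B D => g \oc f)) => [x y|];
  rewrite ?comp0m ?compDl.
Qed.

Lemma comp_sumr n A B D (g : hom C B D) (f : 'I_n -> hom C A B) :
  g \oc (\sum_k f k) = \sum_k (g \oc f k).
Proof.
by apply: (big_morph (fun f : hom C A B => g \oc f)) => [x y|];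
  rewrite ?compm0 ?compDr.
Qed.

Lemma is_iso_idm A : is_iso (idm C A).
Proof. by exists (idm C A); split; rewrite comp1m. Qed.

Lemma is_inverse_comp A B D (f : hom C A B) f' (g : hom C B D) g' :
  is_inverse f f' -> is_inverse g g' -> is_inverse (g \oc f) (f' \oc g').
Proof.
move=> [f1 f2] [g1 g2]; split; rewrite -compmA.
  by rewrite (compmA g') g1 comp1m.
by rewrite (compmA f) f2 comp1m.
Qed.

Lemma is_iso_comp A B D (f : hom C A B) (g : hom C B D) :
  is_iso f -> is_iso g -> is_iso (g \oc f).
Proof. by move=> [f' hf] [g' hg]; exists (f' \oc g'); apply: is_inverse_comp. Qed.

Lemma inverse_square A B A' B' (f : hom C A B) (f' : hom C A' B')
    (a : hom C A A') a1 (b : hom C B B') b1 :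
  is_inverse a a1 -> is_inverse b b1 -> b \oc f = f' \oc a -> b1 \oc f' = f \oc a1.
Proof.
move=> [_ aa1] [b1b _] e.
by rewrite -(compm1 f') -aa1 (compmA f') -e -!compmA compmA b1b comp1m.
Qed.

Lemma is_inverse_sym A B (f : hom C A B) g : is_inverse f g -> is_inverse g f.
Proof. by case. Qed.

Lemma isomorphic_refl A : isomorphic C A A.
Proof. by exists (idm C A); apply: is_iso_idm. Qed.

Lemma isomorphic_sym A B : isomorphic C A B -> isomorphic C B A.
Proof. by move=> [f [g fg]]; exists g, f; apply: is_inverse_sym. Qed.

Lemma isomorphic_trans A B D : isomorphic C A B -> isomorphic C B D -> isomorphic C A D.
Proof. by move=> [f hf] [g hg]; exists (g \oc f); apply: is_iso_comp. Qed.

Lemma is_iso_cancel A B D (f : hom C A B) (g : hom C B D) :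
  is_iso g -> is_iso (g \oc f) -> is_iso f.
Proof.
move=> [g' [g1 g2]] hgf.
have -> : f = g' \oc (g \oc f) by rewrite compmA g1 comp1m.
by apply: is_iso_comp => //; exists g.
Qed.

Lemma zero_objectP Z : is_zero_object C Z <-> idm C Z = 0.
Proof.
split=> [[+ _]|e]; first by move=> /(_ _ (idm C Z)).
by split=> T f; [rewrite -(compm1 f)|rewrite -(comp1m f)]; rewrite e ?compm0 ?comp0m.
Qed.

Lemma pr1_in1A (A B T : ob) (b : biprod C A B) (f : hom C T A) :
  pr1 b \oc (in1 b \oc f) = f.
Proof. by rewrite compmA pr1_in1 comp1m. Qed.

Lemma pr2_in2A (A B T : ob) (b : biprod C A B) (f : hom C T B) :
  pr2 b \oc (in2 b \oc f) = f.
Proof. by rewrite compmA pr2_in2 comp1m. Qed.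

Lemma pr1_in2A (A B T : ob) (b : biprod C A B) (f : hom C T B) :
  pr1 b \oc (in2 b \oc f) = 0.
Proof. by rewrite compmA pr1_in2 comp0m. Qed.

Lemma pr2_in1A (A B T : ob) (b : biprod C A B) (f : hom C T A) :
  pr2 b \oc (in1 b \oc f) = 0.
Proof. by rewrite compmA pr2_in1 comp0m. Qed.

Definition bpE := (compDl, compDr, compBl, compBr, compNl, compNr, comp0m, compm0,
  pr1_in1A, pr2_in2A, pr1_in2A, pr2_in1A, pr1_in1, pr2_in2, pr1_in2, pr2_in1,
  comp1m, compm1, oppr0, addr0, add0r, subr0, sub0r).

Lemma bp_split (A B T : ob) (b : biprod C A B) (f : hom C T (bp_ob b)) :
  f = in1 b \oc (pr1 b \oc f) + in2 b \oc (pr2 b \oc f).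
Proof. by rewrite !compmA -compDl bp_sum comp1m. Qed.

(** The projection onto the kernel is the factorisation of [1 - s p] through it. *)
Lemma split_biprod A B K (p : hom C A B) (s : hom C B A) (i : hom C K A) :
  p \oc s = idm C B -> is_kernel p i ->
  exists b : biprod C B K, bp_ob b = A.
Proof.
move=> ps [pi ker].
have [r [ir _]] : exists! r, i \oc r = idm C A - s \oc p.
  by apply: ker; rewrite compBr compmA ps comp1m compm1 subrr.
have imono T (g h : hom C T K) : i \oc g = i \oc h -> g = h.
  move=> e; have [k [_ uk]] : exists! k, i \oc k = i \oc h.
    by apply: ker; rewrite compmA pi comp0m.
  by rewrite -(uk g e) -(uk h).
have ri : r \oc i = idm C K.
  by apply: imono; rewrite compmA ir compBl -compmA pi compm0 subr0 comp1m compm1.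
have rs : r \oc s = 0.
  by apply: imono; rewrite compmA ir compBl -compmA ps comp1m !compm1 compm0 subrr.
have sm : s \oc p + i \oc r = idm C A by rewrite ir addrC subrK.
by exists (Biprod ps ri pi rs sm).
Qed.

Definition biprod_sym A B (b : biprod C A B) : biprod C B A.
Proof.
apply: (@Biprod _ _ _ _ (bp_ob b) (in2 b) (in1 b) (pr2 b) (pr1 b));
  rewrite ?(pr1_in1, pr1_in2, pr2_in1, pr2_in2) //.
by rewrite addrC bp_sum.
Defined.

(** The new carrier is [S] by computation, not only up to isomorphism, which lets
    closure properties of classes of objects be applied to it. *)
Definition transport_biprod A B (b : biprod C A B) S (f : hom C (bp_ob b) S) g
  (fg : is_inverse f g) : biprod C A B.
Proof.
apply: (@Biprod _ _ _ _ S (f \oc in1 b) (f \oc in2 b) (pr1 b \oc g) (pr2 b \oc g));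
  move: fg => [gf fg]; rewrite -?compmA ?(compmA g) ?gf ?bpE //.
by rewrite -compDr !compmA -compDl bp_sum comp1m.
Defined.

Definition biprod0 A Z (z : idm C Z = 0) : biprod C A Z.
Proof.
apply: (@Biprod _ _ _ _ A (idm C A) 0 (idm C A) 0);
  rewrite ?(bpE, z) ?compm1 ?comp0m ?compm0 ?addr0 //.
Defined.

(** * Finite coproducts *)

(** Stated by equations rather than by the universal property, so that preservation by
    additive functors is immediate. *)
Definition coprod_sys n (A : 'I_n -> ob) S (i : forall k, hom C (A k) S)
    (p : forall k, hom C S (A k)) :=
  [/\ forall k, p k \oc i k = idm C (A k), forall j k, j != k -> p k \oc i j = 0
    & \sum_k i k \oc p k = idm C S].

(** The Kronecker symbol of a family of objects; it needs a cast because [A j] and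
    [A k] are the same object only when [j = k]. *)
Definition kron n (A : 'I_n -> ob) (j k : 'I_n) : hom C (A j) (A k) :=
  match j =P k with
  | ReflectT e => ecast k (hom C (A j) (A k)) e (idm C (A j))
  | ReflectF _ => 0
  end.

Lemma kronkk n (A : 'I_n -> ob) k : kron A k k = idm C (A k).
Proof. by rewrite /kron; case: eqP => // e; rewrite eq_axiomK. Qed.

Lemma kron_neq n (A : 'I_n -> ob) j k : j != k -> kron A j k = 0.
Proof. by rewrite /kron; case: eqP. Qed.

(** The projections are the morphisms with Kronecker components; uniqueness in the
    universal property forces the sum of the idempotents to be the identity. *)
Lemma coprod_sysP n (A : 'I_n -> ob) S (i : forall k, hom C (A k) S) :
  is_coprod i -> exists p, coprod_sys i p.
Proof.
move=> cop; have [p hp] : exists p : forall k, hom C S (A k),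
    forall k j, p k \oc i j = kron A j k.
  exists (fun k => projT1 (cid (cop _ (fun j => kron A j k)))) => k j.
  by case: cid => q /= [].
exists p; split=> [k|j k jk|]; first by rewrite hp kronkk.
  by rewrite hp kron_neq.
have [h [_ uh]] := cop _ i.
rewrite -(uh (idm C S)) => [|k]; last exact: comp1m.
apply/esym/uh => k; rewrite comp_suml (bigD1 k) //= -compmA hp kronkk compm1.
rewrite big1 ?addr0 // => j jk; rewrite -compmA hp kron_neq ?compm0 //.
by rewrite eq_sym.
Qed.

Lemma coprod_sys_coprod n (A : 'I_n -> ob) S (i : forall k, hom C (A k) S) p :
  coprod_sys i p -> is_coprod i.
Proof.
move=> [h1 h2 h3] T f; exists (\sum_k f k \oc p k); split=> [k|h hk].
  rewrite comp_suml (bigD1 k) //= -compmA h1 compm1.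
  by rewrite big1 ?addr0 // => j jk; rewrite -compmA h2 ?compm0 // eq_sym.
rewrite -(compm1 h) -h3 comp_sumr; apply: eq_bigr => k _.
by rewrite compmA hk.
Qed.

Lemma free_classP (X : ob -> Prop) S : free_class C X S <->
  exists n (A : 'I_n -> ob) (i : forall k, hom C (A k) S) p,
    (forall k, X (A k)) /\ coprod_sys i p.
Proof.
split=> [[n [A [i [XA /coprod_sysP [p ip]]]]]|[n [A [i [p [XA ip]]]]]].
  by exists n, A, i, p.
by exists n, A, i; split=> //; apply: coprod_sys_coprod ip.
Qed.

Lemma coprod_sys_iso n (A B : 'I_n -> ob) S (i : forall k, hom C (A k) S) p :
  coprod_sys i p -> (forall k, isomorphic C (A k) (B k)) ->
  exists (j : forall k, hom C (B k) S) q, coprod_sys j q.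
Proof.
move=> [h1 h2 h3] AB.
have AB' k : {fg : hom C (A k) (B k) * hom C (B k) (A k) | is_inverse fg.1 fg.2}.
  by apply/cid; have [f [g fg]] := AB k; exists (f, g).
pose f k := (projT1 (AB' k)).1; pose g k := (projT1 (AB' k)).2.
have fg k : f k \oc g k = idm _ _ by rewrite /f /g; case: (AB' k) => ? [].
have gf k : g k \oc f k = idm _ _ by rewrite /f /g; case: (AB' k) => ? [].
exists (fun k => i k \oc g k), (fun k => f k \oc p k); split=> [k|j k jk|].
- by rewrite -compmA (compmA (p k)) h1 comp1m fg.
- by rewrite -compmA (compmA (p k)) h2 // comp0m compm0.
- by rewrite -h3; apply: eq_bigr => k _; rewrite -compmA (compmA (g k)) gf comp1m.
Qed.

Lemma coprod_sys_uniq n (A : 'I_n -> ob) S S' (i : forall k, hom C (A k) S) p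
    (i' : forall k, hom C (A k) S') p' :
  coprod_sys i p -> coprod_sys i' p' -> isomorphic C S S'.
Proof.
have aux T T' (j : forall k, hom C (A k) T) q (j' : forall k, hom C (A k) T') q' :
    coprod_sys j q -> coprod_sys j' q' ->
    (\sum_k j k \oc q' k) \oc (\sum_k j' k \oc q k) = idm C T.
  move=> [h1 h2 h3] [h1' h2' h3']; rewrite -h3 comp_suml; apply: eq_bigr => k _.
  rewrite -compmA comp_sumr (bigD1 k) //= compmA h1' comp1m big1 ?addr0 // => l lk.
  by rewrite compmA h2' ?comp0m.
by move=> ip ip'; exists (\sum_k i' k \oc p k), (\sum_k i k \oc p' k); split; apply: aux.
Qed.

(** Finite coproducts are built by iterating biproducts, so that they stay in
    any class closed under binary ones. *)
Lemma coprod_ex (Q : ob -> Prop) :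
  (exists Z, idm C Z = 0 /\ Q Z) ->
  (forall A B, Q A -> Q B -> exists b : biprod C A B, Q (bp_ob b)) ->
  forall n (A : 'I_n -> ob), (forall k, Q (A k)) ->
  exists S (i : forall k, hom C (A k) S) p, Q S /\ coprod_sys i p.
Proof.
move=> [Z [z0 QZ]] Qb; elim=> [|n IH] A QA.
  exists Z, (fun=> 0), (fun=> 0); split=> //; split=> [[]//|[]//|].
  by rewrite big_ord0.
have [S [i [p [QS [h1 h2 h3]]]]] := IH (fun k => A (lift ord0 k)) (fun k => QA _).
have [b Qb1] := Qb _ _ (QA ord0) QS.
pose i' k := in1 b \oc kron A k ord0 +
  in2 b \oc \sum_j (i j \oc kron A k (lift ord0 j)).
pose p' k := kron A ord0 k \oc pr1 b +
  (\sum_j (kron A (lift ord0 j) k \oc p j)) \oc pr2 b.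
have i0 : i' ord0 = in1 b.
  rewrite /i' kronkk compm1 big1 ?compm0 ?addr0 // => j _.
  by rewrite kron_neq ?compm0.
have iS j : i' (lift ord0 j) = in2 b \oc i j.
  rewrite /i' kron_neq // compm0 add0r (bigD1 j) //= kronkk compm1.
  rewrite big1 ?addr0 // => l lj; rewrite kron_neq ?compm0 //.
  by rewrite (inj_eq (@lift_inj _ ord0)) eq_sym.
have p0 : p' ord0 = pr1 b.
  rewrite /p' kronkk comp1m big1 ?comp0m ?addr0 // => j _.
  by rewrite kron_neq ?comp0m.
have pS j : p' (lift ord0 j) = p j \oc pr2 b.
  rewrite /p' kron_neq // comp0m add0r (bigD1 j) //= kronkk comp1m.
  rewrite big1 ?addr0 // => l lj; rewrite kron_neq ?comp0m //.
exists (bp_ob b), i', p'; split=> //; split=> [k|j k|].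
- case: (unliftP ord0 k) => [j|] ->; rewrite ?i0 ?p0 ?iS ?pS ?pr1_in1 //.
  by rewrite -compmA pr2_in2A h1.
- case: (unliftP ord0 k) => [k'|] ->; case: (unliftP ord0 j) => [j'|] ->;
    rewrite ?i0 ?p0 ?iS ?pS ?eqxx //; rewrite -?compmA ?bpE //.
  by rewrite (inj_eq lift_inj); apply: h2.
- rewrite big_ord_recl i0 p0 -bp_sum; congr (_ + _).
  rewrite -[pr2 b in RHS]comp1m -h3 comp_suml comp_sumr; apply: eq_bigr => j _.
  by rewrite iS pS -!compmA.
Qed.

(** Each term of a coproduct is a summand; the complement is the coproduct of
    the other terms. *)
Lemma coprod_summand : is_additive C ->
  forall n (A : 'I_n -> ob) S (i : forall k, hom C (A k) S) p,
  coprod_sys i p -> forall k, exists (S' : ob) (b : biprod C (A k) S'), bp_ob b = S.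
Proof.
move=> [[Z /zero_objectP z0] bip] [|n] A S i p [h1 h2 h3] k; first by case: k.
have [|A' B' _ _|S' [i' [p' [_ [h1' h2' h3']]]]] :=
    coprod_ex (Q := fun=> True) _ _ (A := fun j => A (lift k j)) (fun=> I).
- by exists Z.
- by have [b] := bip A' B'; exists b.
pose u := \sum_j i (lift k j) \oc p' j; pose v := \sum_j i' j \oc p (lift k j).
have vu : v \oc u = idm C S'.
  rewrite -h3' /v comp_suml; apply: eq_bigr => j _.
  rewrite -compmA comp_sumr (bigD1 j) //= compmA h1 comp1m big1 ?addr0 // => l lj.
  by rewrite compmA h2 ?comp0m // (inj_eq lift_inj).
have ku : p k \oc u = 0.
  rewrite comp_sumr big1 // => j _; rewrite compmA h2 ?comp0m //.
  by rewrite eq_sym neq_lift.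
have vk : v \oc i k = 0.
  rewrite comp_suml big1 // => j _; rewrite -compmA h2 ?compm0 //.
  by rewrite neq_lift.
have sm : i k \oc p k + u \oc v = idm C S.
  rewrite -h3 (bigD1_ord k) //=; congr (_ + _); rewrite comp_suml.
  apply: eq_bigr => j _; rewrite -compmA comp_sumr (bigD1 j) //= compmA h1' comp1m.
  by rewrite big1 ?addr0 // => l lj; rewrite compmA h2' ?comp0m.
by exists S', (Biprod (h1 k) vu ku vk sm).
Qed.

End Preadditive.

(** * Functors *)

Lemma fullsub_biprod ob (C : precat ob) (P : ob -> Prop) (A B : {A | P A})
    (b : biprod C (sval A) (sval B)) :
  P (bp_ob b) -> exists b' : biprod (fullsub C P) A B, sval (bp_ob b') = bp_ob b.
Proof.
move=> hb; by exists (@Biprod _ (fullsub C P) A B (exist _ (bp_ob b) hb)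
  (in1 b) (in2 b) (pr1 b) (pr2 b) (pr1_in1 b) (pr2_in2 b) (pr1_in2 b) (pr2_in1 b) (bp_sum b)).
Qed.

Section FunctorFacts.
Variables (ob1 ob2 : Type) (C : precat ob1) (D : precat ob2) (F : functor C D).

Lemma fmap0 A B : fmap F (0 : hom C A B) = 0.
Proof. exact: zmod_mor0 (@fmap_zmod _ _ _ _ F A B). Qed.

Lemma fmapD A B (f g : hom C A B) : fmap F (f + g) = fmap F f + fmap F g.
Proof. exact: (zmod_morD (@fmap_zmod _ _ _ _ F A B)). Qed.

Lemma fmapB A B (f g : hom C A B) : fmap F (f - g) = fmap F f - fmap F g.
Proof. exact: (@fmap_zmod _ _ _ _ F A B). Qed.

Lemma fmap_inverse A B (f : hom C A B) g :
  is_inverse f g -> is_inverse (fmap F f) (fmap F g).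
Proof. by move=> [h1 h2]; split; rewrite -fmap_comp ?h1 ?h2 fmap1. Qed.

Lemma fmap_iso A B (f : hom C A B) : is_iso f -> is_iso (fmap F f).
Proof. by move=> [g fg]; exists (fmap F g); apply: fmap_inverse. Qed.

Lemma fob_iso A B : isomorphic C A B -> isomorphic D (F A) (F B).
Proof. by move=> [f hf]; exists (fmap F f); apply: fmap_iso. Qed.

Definition fmap_biprod A B (b : biprod C A B) : biprod D (F A) (F B).
Proof.
apply: (@Biprod _ _ _ _ (F (bp_ob b)) (fmap F (in1 b)) (fmap F (in2 b))
  (fmap F (pr1 b)) (fmap F (pr2 b))); rewrite -!fmap_comp
  ?(pr1_in1, pr1_in2, pr2_in1, pr2_in2, fmap0, fmap1) //.
by rewrite -fmapD bp_sum fmap1.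
Defined.

Lemma fmap_coprod_sys n (A : 'I_n -> ob1) S (i : forall k, hom C (A k) S) p :
  coprod_sys i p -> coprod_sys (fun k => fmap F (i k)) (fun k => fmap F (p k)).
Proof.
move=> [h1 h2 h3]; split=> [k|j k jk|]; rewrite -?fmap_comp ?h1 ?fmap1 //.
  by rewrite h2 // fmap0.
rewrite -(fmap1 F) -h3.
rewrite (big_morph (fmap F (B := S)) (fmapD (B := S)) (fmap0 _ _)).
by apply: eq_bigr => k _; rewrite fmap_comp.
Qed.

Hypothesis ff : fully_faithful F.

Lemma ff_full A B (g : hom D (F A) (F B)) : exists f : hom C A B, fmap F f = g.
Proof. by have [f []] := ff g; exists f. Qed.

Lemma ff_faithful A B (f g : hom C A B) : fmap F f = fmap F g -> f = g.
Proof. by move=> e; have [h [_ uh]] := ff (fmap F g); rewrite -(uh f e) -(uh g). Qed.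

Lemma ff_inverse A B (f : hom C A B) g :
  is_inverse (fmap F f) (fmap F g) -> is_inverse f g.
Proof. by move=> [h1 h2]; split; apply: ff_faithful; rewrite fmap_comp fmap1. Qed.

Lemma ff_isomorphic A B : isomorphic D (F A) (F B) -> isomorphic C A B.
Proof.
move=> [f [g fg]]; have [f' ef] := ff_full f; have [g' eg] := ff_full g.
by exists f', g'; apply: ff_inverse; rewrite ef eg.
Qed.

Lemma ff_zero A : idm D (F A) = 0 -> idm C A = 0.
Proof. by move=> e; apply: ff_faithful; rewrite fmap1 fmap0. Qed.

Lemma ff_biprod A B M (b : biprod D (F A) (F B)) :
  isomorphic D (bp_ob b) (F M) -> exists b' : biprod C A B, bp_ob b' = M.
Proof.
move=> [f [g fg]]; pose b1 := transport_biprod fg.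
have [i1 e1] := ff_full (in1 b1 : hom D (F A) (F M)).
have [i2 e2] := ff_full (in2 b1 : hom D (F B) (F M)).
have [p1 e3] := ff_full (pr1 b1 : hom D (F M) (F A)).
have [p2 e4] := ff_full (pr2 b1 : hom D (F M) (F B)).
have h1 : p1 \oc i1 = idm C A.
  by apply: ff_faithful; rewrite fmap_comp e1 e3 fmap1 (pr1_in1 b1).
have h2 : p2 \oc i2 = idm C B.
  by apply: ff_faithful; rewrite fmap_comp e2 e4 fmap1 (pr2_in2 b1).
have h3 : p1 \oc i2 = 0.
  by apply: ff_faithful; rewrite fmap_comp e2 e3 fmap0 (pr1_in2 b1).
have h4 : p2 \oc i1 = 0.
  by apply: ff_faithful; rewrite fmap_comp e1 e4 fmap0 (pr2_in1 b1).
have h5 : i1 \oc p1 + i2 \oc p2 = idm C M.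
  by apply: ff_faithful; rewrite fmapD !fmap_comp e1 e2 e3 e4 fmap1 (bp_sum b1).
by exists (Biprod h1 h2 h3 h4 h5).
Qed.

(** The inverse chooses a preimage of each object up to isomorphism, and sends a
    morphism to the preimage of its conjugate by the chosen isomorphisms. *)
Section Equivalence.
Hypothesis surj : forall B, exists A, isomorphic D (F A) B.

Let inv_sig (B : ob2) :
  {A : ob1 & {fg : hom D (F A) B * hom D B (F A) | is_inverse fg.1 fg.2}}.
Proof.
have [A h] := cid (surj B); exists A; apply/cid.
by have [f [g fg]] := h; exists (f, g).
Qed.

Let G0 B := projT1 (inv_sig B).
Let th B : hom D (F (G0 B)) B := (sval (projT2 (inv_sig B))).1.
Let ht B : hom D B (F (G0 B)) := (sval (projT2 (inv_sig B))).2.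
Let thht B : is_inverse (th B) (ht B) := svalP (projT2 (inv_sig B)).

Let preim A B (g : hom D (F A) (F B)) : hom C A B := projT1 (cid (ff_full g)).
Let preimK A B (g : hom D (F A) (F B)) : fmap F (preim g) = g.
Proof. by rewrite /preim; case: cid. Qed.

Let ht_th B : ht B \oc th B = idm D (F (G0 B)).
Proof. by have [] := thht B. Qed.
Let th_ht B : th B \oc ht B = idm D B.
Proof. by have [] := thht B. Qed.

Program Definition inv_functor : functor D C :=
  {| fob := G0; fmap A B f := preim (ht B \oc f \oc th A) |}.
Next Obligation.
move=> A B f g; apply: ff_faithful; rewrite fmapB !preimK.
by rewrite compBr compBl.
Qed.
Next Obligation.
by move=> A; apply: ff_faithful; rewrite preimK fmap1 compm1 ht_th.
Qed.
Next Obligation.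
move=> A B E g f; apply: ff_faithful; rewrite fmap_comp !preimK.
by rewrite -!compmA (compmA (th B)) th_ht comp1m.
Qed.

Lemma inv_functor_quasi_inverse : quasi_inverse F inv_functor.
Proof.
split.
  exists (fun A => preim (ht (F A))); split=> [A|A B f].
    exists (preim (th (F A))); apply: ff_inverse; rewrite !preimK.
    exact/is_inverse_sym/thht.
  apply: ff_faithful; rewrite !fmap_comp /= !preimK.
  by rewrite -!compmA th_ht compm1.
exists th; split=> [A|A B f]; first by exists (ht A).
by rewrite /= preimK -!compmA compmA th_ht comp1m.
Qed.

End Equivalence.
End FunctorFacts.

(** * The quotient functor *)
Section QuotientFunctor.
Variables (ob : Type) (C : precat ob) (I : ideal C).

Program Definition qfun : functor C (quotcat I) :=
  {| fob A := A; fmap A B f := qpi I f |}.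
Next Obligation. by move=> A B f g; apply: qpiB. Qed.
Next Obligation. by []. Qed.
Next Obligation.
by move=> A B E g f /=; apply: qpi_comp; rewrite qpi_repr.
Qed.

Lemma qfun_full A B (g : hom (quotcat I) A B) : exists f, fmap qfun f = g.
Proof. by exists (repr g); apply: qpi_repr. Qed.

End QuotientFunctor.

(** * Modules over a preadditive category *)
Section ModuleCategory.
Variables (ob : Type) (Z : precat ob).
Implicit Types G H K L : modl Z.

Lemma mmap0 G A B (f : hom Z A B) : mmap G f 0 = 0.
Proof. exact: zmod_mor0 (mmap_zmod f). Qed.
Lemma mmapB G A B (f : hom Z A B) u v : mmap G f (u - v) = mmap G f u - mmap G f v.
Proof. exact: (mmap_zmod f). Qed.
Lemma mmapD G A B (f : hom Z A B) u v : mmap G f (u + v) = mmap G f u + mmap G f v.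
Proof. exact: (zmod_morD (mmap_zmod f)). Qed.
Lemma mmap0l G A B (u : G B) : mmap G (0 : hom Z A B) u = 0.
Proof. exact: zmod_mor0 (@mmap_zmodl _ _ G A B u). Qed.
Lemma mmapBl G A B (f g : hom Z A B) (u : G B) :
  mmap G (f - g) u = mmap G f u - mmap G g u.
Proof. exact: (@mmap_zmodl _ _ G A B u). Qed.
Lemma mmapDl G A B (f g : hom Z A B) (u : G B) :
  mmap G (f + g) u = mmap G f u + mmap G g u.
Proof. exact: (zmod_morD (@mmap_zmodl _ _ G A B u)). Qed.
Lemma nt_0 G H (s : nattrans G H) A : s A 0 = 0.
Proof. exact: zmod_mor0 (@nt_zmod _ _ _ _ s A). Qed.
Lemma nt_B G H (s : nattrans G H) A u v : s A (u - v) = s A u - s A v.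
Proof. exact: (@nt_zmod _ _ _ _ s A). Qed.
Lemma nt_D G H (s : nattrans G H) A u v : s A (u + v) = s A u + s A v.
Proof. exact: (zmod_morD (@nt_zmod _ _ _ _ s A)). Qed.
Lemma nt_N G H (s : nattrans G H) A u : s A (- u) = - s A u.
Proof. exact: (zmod_morN (@nt_zmod _ _ _ _ s A)). Qed.

Lemma nt_congr G H (s t : nattrans G H) A u : s = t -> s A u = t A u.
Proof. by move->. Qed.

(** Natural transformations are constructed from their graphs: an additive
    relation that is natural, total and single-valued. *)
Lemma nt_rel G H (R : forall A, G A -> H A -> Prop) :
  (forall A u, exists v, R A u v) ->
  (forall A u v u' v', R A u v -> R A u' v' -> R A (u - u') (v - v')) ->
  (forall A v, R A 0 v -> v = 0) ->
  (forall A B (f : hom Z A B) u v, R B u v -> R A (mmap G f u) (mmap H f v)) ->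
  exists s : nattrans G H, forall A u, R A u (s A u).
Proof.
move=> tot add fct nat; pose s A u := projT1 (cid (tot A u)).
have sP A u : R A u (s A u) by rewrite /s; case: cid.
have sU A u v : R A u v -> s A u = v.
  move=> h; apply/eqP; rewrite -subr_eq0; apply/eqP/fct.
  by rewrite -(subrr u); apply: add.
have s1 A : zmod_morphism (s A) by move=> u v; apply: sU; apply: add.
have s2 A B (f : hom Z A B) u : s A (mmap G f u) = mmap H f (s B u).
  by apply: sU; apply: nat.
by exists {| nt := s; nt_zmod := s1; nt_nat := s2 |}.
Qed.

Lemma nt_bij_iso G H (s : nattrans G H) : mod_mono s -> mod_epi s ->
  is_iso (s : hom (modcat Z) G H).
Proof.
move=> inj surj; have [||||t tP] := @nt_rel H G (fun A u v => u = s A v).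
- by move=> A u; apply: surj.
- by move=> A u v u' v' -> ->; rewrite nt_B.
- by move=> A v /esym; apply: inj.
- by move=> A B f u v ->; rewrite nt_nat.
exists t; split; apply: nattransP => A u //=.
apply/eqP; rewrite -subr_eq0; apply/eqP/inj.
by rewrite nt_B -tP subrr.
Qed.

Lemma iso_mono G H (s : nattrans G H) : is_iso (s : hom (modcat Z) G H) -> mod_mono s.
Proof.
move=> [t [ts _]] A u e; have := nt_congr u ts => /= <-.
by rewrite e nt_0.
Qed.

Lemma iso_epi G H (s : nattrans G H) : is_iso (s : hom (modcat Z) G H) -> mod_epi s.
Proof. by move=> [t [_ st]] A u; exists (t A u); rewrite -[LHS](nt_congr u st). Qed.

Lemma mod_mono_comp G H K (s : nattrans G H) (t : nattrans H K) :
  mod_mono s -> mod_mono t -> mod_mono (ntcomp t s).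
Proof. by move=> hs ht A u /= /ht /hs. Qed.

Lemma mod_epi_comp G H K (s : nattrans G H) (t : nattrans H K) :
  mod_epi s -> mod_epi t -> mod_epi (ntcomp t s).
Proof. by move=> hs ht A u; have [v ->] := ht _ u; have [w ->] := hs _ v; exists w. Qed.

Lemma mod_mono_inj G H (s : nattrans G H) : mod_mono s ->
  forall A u v, s A u = s A v -> u = v.
Proof.
by move=> hs A u v e; apply/eqP; rewrite -subr_eq0; apply/eqP/hs; rewrite nt_B e subrr.
Qed.

Lemma mod_lift G H K T (s : nattrans G H) (t : nattrans H K) (g : nattrans T H) :
  mod_mono s -> mod_exact s t -> (forall A u, t A (g A u) = 0) ->
  exists h : nattrans T G, ntcomp s h = g.
Proof.
move=> inj ex tg; have [||||h hP] := @nt_rel T G (fun A u v => g A u = s A v).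
- by move=> A u; apply/ex.
- by move=> A u v u' v' e e'; rewrite !nt_B e e'.
- by move=> A v /esym; rewrite nt_0; apply: inj.
- by move=> A B f u v e; rewrite !nt_nat e.
by exists h; apply: nattransP => A u /=.
Qed.

(** The graph of the descended morphism is the image of [g] along [t]; it is
    single-valued because [g] kills the kernel of [t]. *)
Lemma mod_descend G H K T (s : nattrans G H) (t : nattrans H K) (g : nattrans H T) :
  mod_exact s t -> mod_epi t -> (forall A u, g A (s A u) = 0) ->
  exists h : nattrans K T, ntcomp h t = g.
Proof.
move=> ex epi gs.
have [||||h hP] := @nt_rel K T (fun A u v => exists2 w, u = t A w & v = g A w).
- by move=> A u; have [w ->] := epi A u; exists (g A w), w.
- by move=> A u v u' v' [w -> ->] [w' -> ->]; exists (w - w'); rewrite nt_B.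
- by move=> A v [w /esym /ex [w' ->] ->].
- by move=> A B f u v [w -> ->]; exists (mmap H f w); rewrite nt_nat.
exists h; apply: nattransP => A u /=; have [w e ->] := hP A (t A u).
apply/eqP; rewrite -subr_eq0 -nt_B; apply/eqP.
have /ex [w' ->] : t A (w - u) = 0 by rewrite nt_B e subrr.
exact: gs.
Qed.

Program Definition mod0 : modl Z := {| mo A := ('I_1 : zmodType); mmap A B f u := 0 |}.
Next Obligation. by move=> A B f u v; rewrite subr0. Qed.
Next Obligation. by move=> A B u f g; rewrite subr0. Qed.
Next Obligation. by move=> A u; rewrite (ord1 u). Qed.
Next Obligation. by []. Qed.

Program Definition modsum G H : modl Z :=
  {| mo A := (G A * H A : zmodType)%type;
     mmap A B f u := (mmap G f u.1, mmap H f u.2) |}.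
Next Obligation. by move=> G H A B f u v; rewrite /= !mmapB. Qed.
Next Obligation. by move=> G H A B u f g; rewrite !mmapBl. Qed.
Next Obligation. by move=> G H A [u v]; rewrite !mmap1. Qed.
Next Obligation. by move=> G H A B D g f [u v]; rewrite !mmap_comp. Qed.

Program Definition min1 G H : nattrans G (modsum G H) := {| nt A u := (u, 0) |}.
Next Obligation. by move=> G H A u v; congr pair; rewrite subr0. Qed.
Next Obligation. by move=> G H A B f u; rewrite /= mmap0. Qed.
Program Definition min2 G H : nattrans H (modsum G H) := {| nt A u := (0, u) |}.
Next Obligation. by move=> G H A u v; congr pair; rewrite subr0. Qed.
Next Obligation. by move=> G H A B f u; rewrite /= mmap0. Qed.
Program Definition mpr1 G H : nattrans (modsum G H) G := {| nt A u := u.1 |}.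
Next Obligation. by []. Qed.
Next Obligation. by []. Qed.
Program Definition mpr2 G H : nattrans (modsum G H) H := {| nt A u := u.2 |}.
Next Obligation. by []. Qed.
Next Obligation. by []. Qed.

Definition mod_biprod G H : biprod (modcat Z) G H.
Proof.
apply: (@Biprod _ (modcat Z) G H (modsum G H) (min1 G H) (min2 G H) (mpr1 G H) (mpr2 G H));
  apply: nattransP => A u //=.
by case: u => u v; congr pair; rewrite /= ?addr0 ?add0r.
Defined.

Lemma modsum_exact G H : mod_short_exact (min1 G H) (mpr2 G H).
Proof.
split=> [A u [] //|A [u v]|A u]; last by exists (0, u).
by split=> /= [->|[w []]//]; exists u.
Qed.

Section Kernel.
Variables (G H : modl Z) (s : nattrans G H).

Definition ker_pred A : {pred G A} := fun u => s A u == 0.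
Lemma ker_pred_closed A : zmod_closed (@ker_pred A).
Proof.
split=> [|u v]; rewrite /ker_pred !unfold_in ?nt_0 // => /eqP hu /eqP hv.
by rewrite nt_B hu hv subrr.
Qed.
HB.instance Definition _ A := GRing.isZmodClosed.Build _ (@ker_pred A) (@ker_pred_closed A).

Record ker_type A := KerType { ker_val :> G A; ker_valP : ker_val \in @ker_pred A }.
HB.instance Definition _ A := [isSub for @ker_val A].
HB.instance Definition _ A := [Choice of ker_type A by <:].
HB.instance Definition _ A := [SubChoice_isSubZmodule of ker_type A by <:].

Lemma ker_mmapP A B (f : hom Z A B) (u : ker_type B) : mmap G f (ker_val u) \in @ker_pred A.
Proof. by rewrite unfold_in nt_nat (eqP (ker_valP u)) mmap0. Qed.

Program Definition kermod : modl Z :=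
  {| mo A := ker_type A; mmap A B f u := KerType (ker_mmapP f u) |}.
Next Obligation. by move=> A B f u v; apply: val_inj; rewrite /= -mmapB. Qed.
Next Obligation. by move=> A B u f g; apply: val_inj; rewrite /= mmapBl. Qed.
Next Obligation. by move=> A u; apply: val_inj; rewrite /= mmap1. Qed.
Next Obligation. by move=> A B D g f u; apply: val_inj; rewrite /= mmap_comp. Qed.

Program Definition kerincl : nattrans kermod G := {| nt A u := ker_val u |}.
Next Obligation. by []. Qed.
Next Obligation. by []. Qed.

Lemma kerincl_mono : mod_mono kerincl.
Proof. by move=> A u e; apply: val_inj. Qed.

Lemma kerincl_exact : mod_exact kerincl s.
Proof.
move=> A u; split=> [e|[v ->]]; last exact/eqP/(ker_valP v).
by have h : u \in @ker_pred A; [rewrite unfold_in e|exists (KerType h)].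
Qed.

Definition im_pred A : {pred H A} := fun u => `[< exists v, u = s A v >].
Lemma im_pred_closed A : zmod_closed (@im_pred A).
Proof.
split=> [|u v]; rewrite /im_pred !unfold_in; first by apply/asboolP; exists 0; rewrite nt_0.
by move=> /asboolP [u' ->] /asboolP [v' ->]; apply/asboolP; exists (u' - v'); rewrite nt_B.
Qed.
HB.instance Definition _ A := GRing.isZmodClosed.Build _ (@im_pred A) (@im_pred_closed A).

Definition coker_type (A : ob) : zmodType := {ideal_quot (@im_pred A)}.
Definition coker_pi A (u : H A) : coker_type A := (\pi_{ideal_quot (@im_pred A)} u)%qT.

Lemma coker_pi_eq A (u v : H A) : coker_pi u = coker_pi v <-> exists w, u - v = s A w.
Proof.
rewrite /coker_pi; split=> [/eqP|].
  by rewrite -Quotient.idealrBE => /asboolP.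
by move=> h; apply/eqP; rewrite -Quotient.idealrBE; apply/asboolP.
Qed.

Lemma coker_piB A : zmod_morphism (@coker_pi A).
Proof. by move=> u v; rewrite /coker_pi !piE. Qed.

Lemma coker_repr A (x : coker_type A) : coker_pi (repr x) = x.
Proof. exact: reprK. Qed.

Lemma coker_mmap A B (f : hom Z A B) u v : coker_pi u = coker_pi v ->
  coker_pi (mmap H f u) = coker_pi (mmap H f v).
Proof.
by move=> /coker_pi_eq [w e]; apply/coker_pi_eq; exists (mmap G f w);
  rewrite nt_nat -e mmapB.
Qed.

Program Definition cokermod : modl Z :=
  {| mo A := coker_type A; mmap A B f u := coker_pi (mmap H f (repr u)) |}.
Next Obligation.
move=> A B f u v /=; rewrite -coker_piB -mmapB; apply: coker_mmap.
by rewrite coker_piB !coker_repr.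
Qed.
Next Obligation. by move=> A B u f g /=; rewrite mmapBl coker_piB. Qed.
Next Obligation. by move=> A u /=; rewrite mmap1 coker_repr. Qed.
Next Obligation.
by move=> A B D g f u /=; rewrite mmap_comp; apply: coker_mmap; rewrite coker_repr.
Qed.

Program Definition cokerproj : nattrans H cokermod := {| nt A u := coker_pi u |}.
Next Obligation. by move=> A; apply: coker_piB. Qed.
Next Obligation. by move=> A B f u /=; apply: coker_mmap; rewrite coker_repr. Qed.

Lemma cokerproj_epi : mod_epi cokerproj.
Proof. by move=> A u; exists (repr u); rewrite /= coker_repr. Qed.

Lemma cokerproj_exact : mod_exact s cokerproj.
Proof.
move=> A u; rewrite -(nt_0 cokerproj) /=; split=> [/coker_pi_eq [w]|[w e]].
  by rewrite subr0; exists w.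
by apply/coker_pi_eq; exists w; rewrite subr0.
Qed.

End Kernel.

Lemma ses_iso G H K G' H' K' (s : nattrans G H) (t : nattrans H K)
    (s' : nattrans G' H') (t' : nattrans H' K')
    (a : nattrans G G') (b : nattrans H H') (c : nattrans K K') :
  is_iso (a : hom (modcat Z) _ _) -> is_iso (b : hom (modcat Z) _ _) ->
  is_iso (c : hom (modcat Z) _ _) ->
  ntcomp b s = ntcomp s' a -> ntcomp c t = ntcomp t' b ->
  mod_short_exact s t -> mod_short_exact s' t'.
Proof.
move=> ia ib ic e1 e2 [inj ex epi].
have E1 A u := nt_congr (A := A) u e1; have E2 A u := nt_congr (A := A) u e2.
simpl in E1, E2; split=> A u.
- have [v ->] := iso_epi ia u; rewrite -E1 => /(iso_mono ib) /inj ->.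
  by rewrite nt_0.
- have [v ->] := iso_epi ib u; rewrite -E2; split=> [/(iso_mono ic) /ex [w ->]|[w]].
    by exists (a A w); rewrite E1.
  have [w' ->] := iso_epi ia w; rewrite -E1 => /(mod_mono_inj (iso_mono ib)) e.
  by rewrite (_ : t A v = 0) ?nt_0 //; apply/ex; exists w'.
- have [v ->] := iso_epi ic u; have [w ->] := epi A v.
  by exists (b A w); rewrite E2.
Qed.

End ModuleCategory.

Arguments cokerproj_epi {ob Z G H} s.
Arguments cokerproj_exact {ob Z G H} s.
Arguments kerincl_mono {ob Z G H} s.
Arguments kerincl_exact {ob Z G H} s.

(** * Exact structures induced by functors to module categories *)
Section InducedExactStructure.
Variables (ob1 ob2 : Type) (D : precat ob1) (Z : precat ob2).
Variable F : functor D (modcat Z).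
Hypothesis ff : fully_faithful F.

Definition fnt A B (f : hom D A B) : nattrans (F A) (F B) := fmap F f.

Definition ses_preimage : seq_class D := fun A B E i p =>
  @mod_short_exact _ Z _ _ _ (fnt i) (fnt p).

Definition in_image (G : modl Z) := exists M, isomorphic (modcat Z) G (F M).

Lemma fnt_full A B (s : nattrans (F A) (F B)) : exists f, fnt f = s.
Proof. exact: (@ff_full _ _ _ _ F ff A B s). Qed.

Lemma fnt_inj A B (f g : hom D A B) : (forall T u, fnt f T u = fnt g T u) -> f = g.
Proof. by move=> e; apply: (ff_faithful ff); apply: nattransP. Qed.

Lemma fnt_comp A B E (g : hom D B E) (f : hom D A B) T u :
  fnt (g \oc f) T u = fnt g T (fnt f T u).
Proof. exact: nt_congr u (fmap_comp F g f). Qed.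

Lemma fnt_idm A T u : fnt (idm D A) T u = u.
Proof. exact: nt_congr u (fmap1 F A). Qed.

Lemma fnt0 A B T u : fnt (0 : hom D A B) T u = 0.
Proof. exact: nt_congr u (fmap0 F A B). Qed.

Lemma fnt_kernel A B E (i : hom D A B) (p : hom D B E) :
  mod_mono (fnt i) -> mod_exact (fnt i) (fnt p) -> is_kernel p i.
Proof.
move=> inj ex; split.
  by apply: fnt_inj => T u; rewrite fnt_comp fnt0; apply/ex; exists u.
move=> T g pg; have [|h0 ih] := mod_lift inj ex (g := fnt g).
  by move=> S u; rewrite -fnt_comp pg fnt0.
have [h eh] := fnt_full h0; exists h; split=> [|h' ih'].
  by apply: fnt_inj => S u; rewrite fnt_comp eh -ih.
apply: fnt_inj => S u; apply: (mod_mono_inj inj).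
by rewrite eh -fnt_comp ih' -ih.
Qed.

Lemma fnt_cokernel A B E (i : hom D A B) (p : hom D B E) :
  mod_exact (fnt i) (fnt p) -> mod_epi (fnt p) -> is_cokernel i p.
Proof.
move=> ex epi; split.
  by apply: fnt_inj => T u; rewrite fnt_comp fnt0; apply/ex; exists u.
move=> T g gi; have [|h0 hp] := mod_descend ex epi (g := fnt g).
  by move=> S u; rewrite -fnt_comp gi fnt0.
have [h eh] := fnt_full h0; exists h; split=> [|h' hp'].
  by apply: fnt_inj => S u; rewrite fnt_comp eh -hp.
apply: fnt_inj => S u; have [v ->] := epi S u.
by rewrite eh -fnt_comp hp' -hp.
Qed.

Lemma preimage_cokernel A B (i : hom D A B) Q (t : nattrans (F B) Q) :
  mod_mono (fnt i) -> mod_exact (fnt i) t -> mod_epi t -> in_image Q ->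
  admissible_mono ses_preimage i.
Proof.
move=> inj ex epi [M [f [g fg]]].
have fi : is_iso f by exists g.
have [p ep] := fnt_full (ntcomp f t); exists M, p; split=> //; rewrite ep.
  move=> A' u; rewrite -ex; split=> /= [|->]; last by rewrite nt_0.
  exact: iso_mono fi _ _.
exact: mod_epi_comp epi (iso_epi fi).
Qed.

Lemma preimage_kernel B E (p : hom D B E) Q (s : nattrans Q (F B)) :
  mod_mono s -> mod_exact s (fnt p) -> mod_epi (fnt p) -> in_image Q ->
  admissible_epi ses_preimage p.
Proof.
move=> inj ex epi [M [f [g fg]]].
have gi : is_iso g by exists f; apply: is_inverse_sym.
have [i ei] := fnt_full (ntcomp s g); exists M, i; split=> //; rewrite ei.
  exact: mod_mono_comp (iso_mono gi) inj.
move=> A u; rewrite ex; split=> [[v ->]|[v ->]]; last by exists (g A v).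
by have [w ->] := iso_epi gi v; exists w.
Qed.

Hypothesis image0 : exists M, forall A (u : F M A), u = 0.
Hypothesis image_ext : forall A B (G : modl Z) (s : nattrans (F A) G)
  (t : nattrans G (F B)), mod_short_exact s t -> in_image G.

Lemma preimage_additive : is_additive D.
Proof.
split.
  have [M M0] := image0; exists M; apply/zero_objectP/fnt_inj => A u.
  by rewrite (M0 _ u) !nt_0.
move=> A B; have [M iM] := image_ext (modsum_exact (F A) (F B)).
by have [b _] := ff_biprod ff (b := mod_biprod (F A) (F B)) iM.
Qed.

(** The cokernel of a composite of monomorphisms is an extension of the two
    cokernels. *)
Lemma admissible_mono_comp A B E (f : hom D A B) (g : hom D B E) :
  admissible_mono ses_preimage f -> admissible_mono ses_preimage g ->
  admissible_mono ses_preimage (g \oc f).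
Proof.
move=> [P1 [p1 [f1 fp1 p1e]]] [P2 [p2 [g1 gp2 p2e]]].
have gfi : mod_mono (fnt (g \oc f)).
  by move=> T u; rewrite fnt_comp => /g1 /f1.
have cex := cokerproj_exact (fnt (g \oc f)); have cepi := cokerproj_epi (fnt (g \oc f)).
set c := cokerproj _ in cex cepi; clearbody c.
have [|j jp] := mod_descend fp1 p1e (g := ntcomp c (fnt g)).
  by move=> T u; apply/cex; exists u; rewrite fnt_comp.
have [|r rc] := mod_descend cex cepi (g := fnt p2).
  by move=> T u; rewrite fnt_comp; apply/gp2; eexists.
have jE T u : j T (fnt p1 T u) = c T (fnt g T u) := nt_congr u jp.
have rE T u : r T (c T u) = fnt p2 T u := nt_congr u rc.
apply: (preimage_cokernel gfi cex cepi).
apply: (image_ext (s := j) (t := r)); split=> T u.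
- have [b ->] := p1e T u; rewrite jE => /cex [a]; rewrite fnt_comp.
  by move/(mod_mono_inj g1) => ->; apply/fp1; exists a.
- split=> [|[v ->]].
    have [e ->] := cepi T u; rewrite rE => /gp2 [b ->].
    by exists (fnt p1 T b); rewrite jE.
  by have [b ->] := p1e T v; rewrite jE rE; apply/gp2; exists b.
- by have [e ->] := p2e T u; exists (c T e); rewrite rE.
Qed.

(** The kernel of a composite of epimorphisms is an extension of the two kernels. *)
Lemma admissible_epi_comp A B E (f : hom D A B) (g : hom D B E) :
  admissible_epi ses_preimage f -> admissible_epi ses_preimage g ->
  admissible_epi ses_preimage (g \oc f).
Proof.
move=> [K1 [i1 [i1m if1 fe]]] [K2 [i2 [i2m ig2 ge]]].
have gfe : mod_epi (fnt (g \oc f)).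
  move=> T u; have [b ->] := ge T u; have [a ->] := fe T b.
  by exists a; rewrite fnt_comp.
have kex := kerincl_exact (fnt (g \oc f)).
have kmono := kerincl_mono (fnt (g \oc f)).
set k := kerincl _ in kex kmono; clearbody k.
have [|j kj] := mod_lift kmono kex (g := fnt i1).
  move=> T u; rewrite fnt_comp.
  have -> : fnt f T (fnt i1 T u) = 0 by apply/if1; exists u.
  exact: nt_0.
have [|r ir] := mod_lift i2m ig2 (g := ntcomp (fnt f) k).
  by move=> T u /=; rewrite -fnt_comp; apply/kex; exists u.
have jE T u : k T (j T u) = fnt i1 T u := nt_congr u kj.
have rE T u : fnt i2 T (r T u) = fnt f T (k T u) := nt_congr u ir.
apply: (preimage_kernel kmono kex gfe).
apply: (image_ext (s := j) (t := r)); split=> T u.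
- by move=> ju; apply: i1m; rewrite -jE ju nt_0.
- split=> [ru|[v ->]].
    have /if1 [v e] : fnt f T (k T u) = 0 by rewrite -rE ru nt_0.
    by exists v; apply: (mod_mono_inj kmono); rewrite jE.
  by apply: i2m; rewrite rE jE; apply/if1; exists v.
- have [a e] := fe T (fnt i2 T u).
  have /kex [w ew] : fnt (g \oc f) T a = 0.
    by rewrite fnt_comp -e; apply/ig2; exists u.
  by exists w; apply: (mod_mono_inj i2m); rewrite rE -ew.
Qed.

(** The pushout of [i] along [f], computed in modules, is an extension of the
    cokernel of [i] by the target of [f]. *)
Lemma admissible_pushout A B A' (i : hom D A B) (f : hom D A A') :
  admissible_mono ses_preimage i ->
  exists (B' : ob1) (i' : hom D A' B') (f' : hom D B B'),
    is_pushout i f i' f' /\ admissible_mono ses_preimage i'.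
Proof.
move=> [E [p [im ip pe]]].
pose s : nattrans (F A) (modsum (F B) (F A')) :=
  ntD (ntcomp (min1 _ _) (fnt i)) (ntN (ntcomp (min2 _ _) (fnt f))).
have sE T u : s T u = (fnt i T u, - fnt f T u).
  by congr pair; rewrite /= ?oppr0 ?addr0 ?add0r.
have cex := cokerproj_exact s; have cepi := cokerproj_epi s.
set c := cokerproj _ in cex cepi; clearbody c.
have cE T b a' a : c T (b + fnt i T a, a') = c T (b, a' + fnt f T a).
  apply/eqP; rewrite -subr_eq0 -nt_B; apply/eqP/cex; exists a; rewrite sE.
  congr pair => /=; first by rewrite addrC addrA addNr add0r.
  by rewrite opprD addrA subrr add0r.
have [|r rc] := mod_descend cex cepi (g := ntcomp (fnt p) (mpr1 _ _)).
  by move=> T u; rewrite sE /=; apply/ip; exists u.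
have rE T b a' : r T (c T (b, a')) = fnt p T b := nt_congr ((b, a') : modsum (F B) (F A') _) rc.
pose j := ntcomp c (min2 (F B) (F A')).
have jr : mod_short_exact j r.
  split=> T u.
  - move=> /cex [a]; rewrite sE => -[/esym /im ->].
    by rewrite nt_0 oppr0.
  - split=> [|[a' ->]]; last by rewrite rE nt_0.
    have [[b a'] ->] := cepi T u; rewrite rE => /ip [a ->].
    exists (a' + fnt f T a); rewrite -{1}(add0r (fnt i T a)).
    by rewrite cE.
  - by have [b ->] := pe T u; exists (c T (b, 0)); rewrite rE.
have [B' [phi [psi [psiphi phipsi]]]] := image_ext jr.
have phiK T u : psi T (phi T u) = u := nt_congr u psiphi.
have psiK T u : phi T (psi T u) = u := nt_congr u phipsi.
have [i' ei] := fnt_full (ntcomp phi j).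
have [f' ef] := fnt_full (ntcomp phi (ntcomp c (min1 _ _))).
exists B', i', f'; split; first split.
- apply: fnt_inj => T u; rewrite !fnt_comp ei ef /=; congr (phi T _).
  by have := cE T 0 0 u; rewrite !add0r.
- move=> T g h gh.
  pose m := ntD (ntcomp (fnt g) (mpr1 (F B) (F A'))) (ntcomp (fnt h) (mpr2 _ _)).
  have [|k0 kc] := mod_descend cex cepi (g := m).
    by move=> S u; rewrite sE /= -fnt_comp gh fnt_comp nt_N subrr.
  have kE S b a' : k0 S (c S (b, a')) = fnt g S b + fnt h S a' := nt_congr ((b, a') : modsum (F B) (F A') _) kc.
  have [k ek] := fnt_full (ntcomp k0 psi).
  exists k; split=> [|k' [kf' ki']].
    by split; apply: fnt_inj => S u; rewrite fnt_comp ek ?ei ?ef /= phiK kE nt_0 ?addr0 ?add0r.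
  apply: fnt_inj => S u; rewrite -(psiK S u); have [[b a'] ->] := cepi S (psi S u).
  rewrite ek /= phiK kE -kf' -ki' !fnt_comp ei ef /=.
  have -> : (b, a') = ((b, 0) : modsum (F B) (F A') S) + (0, a').
    by congr pair; rewrite /= ?addr0 ?add0r.
  by rewrite !nt_D.
- have [p' ep'] := fnt_full (ntcomp r psi); exists E, p'.
  apply: (@ses_iso _ Z _ _ _ _ _ _ j r _ _ (nt1 _) phi (nt1 _)) => //;
    try exact: (is_iso_idm (modcat Z)).
  + by exists psi.
  + by rewrite ei; apply: nattransP.
  + by rewrite ep'; apply: nattransP => T u /=; rewrite phiK.
Qed.

(** The pullback of [p] along [f], computed in modules, is an extension of the
    source of [f] by the kernel of [p]. *)
Lemma admissible_pullback B E E' (p : hom D B E) (f : hom D E' E) :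
  admissible_epi ses_preimage p ->
  exists (B' : ob1) (p' : hom D B' E') (f' : hom D B' B),
    is_pullback p f p' f' /\ admissible_epi ses_preimage p'.
Proof.
move=> [A [i [im ip pe]]].
pose s : nattrans (modsum (F B) (F E')) (F E) :=
  ntD (ntcomp (fnt p) (mpr1 _ _)) (ntN (ntcomp (fnt f) (mpr2 _ _))).
have sE T b e : s T (b, e) = fnt p T b - fnt f T e by [].
have kex := kerincl_exact s; have kmono := kerincl_mono s.
set k := kerincl _ in kex kmono; clearbody k.
have kP T u : fnt p T (k T u).1 = fnt f T (k T u).2.
  apply/eqP; rewrite -subr_eq0 -sE -surjective_pairing; apply/eqP/kex.
  by exists u.
have [|j kj] := mod_lift kmono kex (g := ntcomp (min1 _ (F E')) (fnt i)).
  move=> T u; rewrite /= nt_0 subr0; apply/ip; by exists u.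
have jE T u : k T (j T u) = (fnt i T u, 0) := nt_congr u kj.
pose r := ntcomp (mpr2 (F B) (F E')) k.
have jr : mod_short_exact j r.
  split=> T u.
  - by move=> ju; apply: im; have := jE T u; rewrite ju nt_0 => -[->].
  - split=> [/= ru|[a ->]]; last by rewrite /= jE.
    have /ip [a ea] : fnt p T (k T u).1 = 0 by rewrite kP ru nt_0.
    by exists a; apply: (mod_mono_inj kmono); rewrite jE -ea -ru -surjective_pairing.
  - have [b eb] := pe T (fnt f T u).
    have /kex [w ew] : s T (b, u) = 0 by rewrite sE -eb subrr.
    by exists w; rewrite /= -ew.
have [B' [phi [psi [psiphi phipsi]]]] := image_ext jr.
have phiK T u : psi T (phi T u) = u := nt_congr u psiphi.
have psiK T u : phi T (psi T u) = u := nt_congr u phipsi.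
have [p' ep] := fnt_full (ntcomp r psi).
have [f' ef] := fnt_full (ntcomp (ntcomp (mpr1 _ _) k) psi).
exists B', p', f'; split; first split.
- by apply: fnt_inj => T u; rewrite !fnt_comp ep ef /= kP.
- move=> T g h gh.
  pose m := ntD (ntcomp (min1 (F B) (F E')) (fnt g)) (ntcomp (min2 _ _) (fnt h)).
  have mE S u : m S u = (fnt g S u, fnt h S u) by congr pair; rewrite /= ?addr0 ?add0r.
  have [|l0 kl] := mod_lift kmono kex (g := m).
    by move=> S u; rewrite mE sE -!fnt_comp gh subrr.
  have lE S u : k S (l0 S u) = (fnt g S u, fnt h S u) by rewrite -mE -kl.
  have [l el] := fnt_full (ntcomp phi l0).
  exists l; split=> [|l' [fl' pl']].
    by split; apply: fnt_inj => S u; rewrite fnt_comp el ?ep ?ef /= phiK lE.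
  apply: fnt_inj => S u; rewrite el /= -[RHS]psiK; congr (phi S _).
  apply: (mod_mono_inj kmono); rewrite lE -fl' -pl' !fnt_comp ep ef /=.
  by rewrite -surjective_pairing.
- have [i' ei'] := fnt_full (ntcomp phi j); exists A, i'.
  apply: (@ses_iso _ Z _ _ _ _ _ _ j r _ _ (nt1 _) phi (nt1 _)) => //;
    try exact: (is_iso_idm (modcat Z)).
  + by exists psi.
  + by rewrite ei'; apply: nattransP.
  + by rewrite ep; apply: nattransP => T u /=; rewrite phiK.
Qed.

(** Apart from a zero object, every object that the axioms ask for is built in the
    module category as an extension of objects of the image, and so is in the image. *)
Theorem preimage_exact : is_exact_category ses_preimage.
Proof.
have [M M0] := image0.
split.
- exact: preimage_additive.
- move=> A B E i p [im ip pe]; split; [exact: fnt_kernel|exact: fnt_cokernel].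
- move=> A B E i p A' B' E' i' p' a b d ia ib id e1 e2.
  apply: (@ses_iso _ Z _ _ _ _ _ _ _ _ _ _ (fnt a) (fnt b) (fnt d));
    try exact: fmap_iso.
    by apply: nattransP => T u; rewrite /= -!fnt_comp e1.
  by apply: nattransP => T u; rewrite /= -!fnt_comp e2.
- move=> A; exists M, 0; split=> [T u|T u|T u].
  + by rewrite fnt_idm.
  + split=> _; first by exists u; rewrite fnt_idm.
    by rewrite fnt0.
  + by exists 0; rewrite (M0 _ u) nt_0.
- move=> A; exists M, 0; split=> [T u _|T u|T u].
  + exact: M0.
  + rewrite fnt_idm; split=> [->|[v ->]]; first by exists 0; rewrite nt_0.
    by rewrite fnt0.
  + by exists u; rewrite fnt_idm.
- exact: admissible_mono_comp.
- exact: admissible_epi_comp.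
- exact: admissible_pushout.
- exact: admissible_pullback.
Qed.

Section Abelian.
Hypothesis image_ker : forall A B (f : hom D A B), in_image (kermod (fnt f)).
Hypothesis image_coker : forall A B (f : hom D A B), in_image (cokermod (fnt f)).

Lemma preimage_ker_ex A B (f : hom D A B) :
  exists (K : ob1) (i : hom D K A), mod_mono (fnt i) /\ mod_exact (fnt i) (fnt f).
Proof.
have [K [phi [psi fg]]] := image_ker f.
have hi : is_iso psi by exists phi; apply: is_inverse_sym.
have [i ei] := fnt_full (ntcomp (kerincl (fnt f)) psi).
exists K, i; rewrite ei; split.
  exact: mod_mono_comp (iso_mono hi) (kerincl_mono _).
move=> T u; rewrite (kerincl_exact (fnt f)); split=> [[v ->]|[v ->]].
  by have [w ->] := iso_epi hi v; exists w.
by exists (psi T v).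
Qed.

Lemma preimage_coker_ex A B (f : hom D A B) :
  exists (Q : ob1) (p : hom D B Q), mod_exact (fnt f) (fnt p) /\ mod_epi (fnt p).
Proof.
have [Q [phi [psi fg]]] := image_coker f.
have hi : is_iso phi by exists psi.
have [p ep] := fnt_full (ntcomp phi (cokerproj (fnt f))).
exists Q, p; rewrite ep; split.
  move=> T u; rewrite -(cokerproj_exact (fnt f)); split=> /= [|->]; last by rewrite nt_0.
  exact: iso_mono hi _ _.
exact: mod_epi_comp (cokerproj_epi _) (iso_epi hi).
Qed.

(** The kernel of [F f] is the value of [F] at a kernel of [f], and so vanishes
    together with it. *)
Lemma preimage_mono A B (f : hom D A B) : is_mono f -> mod_mono (fnt f).
Proof.
move=> fm; have [K [i [im ex]]] := preimage_ker_ex f.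
have i0 : i = 0.
  apply: fm; rewrite compm0; apply: fnt_inj => T u.
  by rewrite fnt_comp fnt0; apply/ex; exists u.
by move=> T u /ex [v ->]; rewrite i0 fnt0.
Qed.

Lemma preimage_epi A B (f : hom D A B) : is_epi f -> mod_epi (fnt f).
Proof.
move=> fe; have [Q [p [ex pe]]] := preimage_coker_ex f.
have p0 : p = 0.
  apply: fe; rewrite comp0m; apply: fnt_inj => T u.
  by rewrite fnt_comp fnt0; apply/ex; exists u.
by move=> T u; apply/ex; rewrite p0 fnt0.
Qed.

Lemma preimage_abelian : is_abelian D.
Proof.
split.
- exact: preimage_additive.
- move=> A B f; have [K [i [im ex]]] := preimage_ker_ex f.
  by exists K, i; apply: fnt_kernel.
- move=> A B f; have [K [i [im ex]]] := preimage_coker_ex f.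
  by exists K, i; apply: fnt_cokernel.
- move=> A B f /preimage_mono fm; have [Q [p [ex pe]]] := preimage_coker_ex f.
  by exists Q, p; apply: fnt_kernel.
- move=> A B f /preimage_epi fm; have [Q [p [ex pe]]] := preimage_ker_ex f.
  by exists Q, p; apply: fnt_cokernel.
Qed.

Lemma kernel_mono A B E (p : hom D B E) (i : hom D A B) : is_kernel p i -> is_mono i.
Proof.
move=> [pi ker] T g h e; have [|k [_ uk]] := ker T (i \oc h).
  by rewrite compmA pi comp0m.
by rewrite -(uk g e) -(uk h).
Qed.

Lemma cokernel_epi A B E (p : hom D B E) (i : hom D A B) : is_cokernel i p -> is_epi p.
Proof.
move=> [pi cok] T g h e; have [|k [_ uk]] := cok T (h \oc p).
  by rewrite -compmA pi compm0.
by rewrite -(uk g e) -(uk h).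
Qed.

(** Kernels and cokernels in [D] are sent to those of modules, so that the
    categorical notion of short exact sequence is the pointwise one. *)
Theorem preimage_abelian_exact : is_abelian_exact_category ses_preimage.
Proof.
split; [exact: preimage_exact|exact: preimage_abelian|].
move=> A B E i p; split; first exact: (exc_pair preimage_exact).
move=> [kp ci]; have im := preimage_mono (kernel_mono kp).
split=> //; last exact: preimage_epi (cokernel_epi ci).
have [pi ker] := kp; have [K [k [km kex]]] := preimage_ker_ex p.
have pk : p \oc k = 0.
  by apply: fnt_inj => T u; rewrite fnt_comp fnt0; apply/kex; exists u.
have [h [ih _]] := ker _ k pk.
move=> T u; split=> [/kex [v ->]|[v ->]].
  by exists (fnt h T v); rewrite -fnt_comp ih.
by rewrite -fnt_comp pi fnt0.
Qed.

End Abelian.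
End InducedExactStructure.

Section FullSubcategory.
Variables (ob : Type) (C : precat ob) (P : ob -> Prop).

Program Definition id_functor : functor C C := {| fob A := A; fmap A B f := f |}.
Next Obligation. by []. Qed.
Next Obligation. by []. Qed.
Next Obligation. by []. Qed.

Definition inclusion : functor (fullsub C P) C := restrict id_functor P.

Lemma inclusion_ff : fully_faithful inclusion.
Proof. by move=> A B g; exists g; split. Qed.

End FullSubcategory.

(** * Presentations of modules *)

Lemma free_class1 ob (C : precat ob) (X : ob -> Prop) A : X A -> free_class C X A.
Proof.
move=> XA; apply/free_classP; exists 1%N, (fun=> A), (fun=> idm C A), (fun=> idm C A).
split=> //; split=> [k|j k|]; rewrite ?comp1m //; first by rewrite !ord1 eqxx.
by rewrite big_ord1.
Qed.

Section Presentations.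
Variables (ob : Type) (Z : precat ob).
Implicit Types G H : modl Z.

Program Definition yoneda_nt G T (g : G T) : nattrans (yoneda Z T) G :=
  {| nt A u := mmap G u g |}.
Next Obligation. by move=> G T g A u v; apply: mmapBl. Qed.
Next Obligation. by move=> G T g A B f u; apply: mmap_comp. Qed.

Lemma yoneda_ntE G T (s : nattrans (yoneda Z T) G) A (u : hom Z A T) :
  s A u = mmap G u (s T (idm Z T)).
Proof. by rewrite -nt_nat /= comp1m. Qed.

Program Definition yoneda_functor : functor Z (modcat Z) :=
  {| fob := yoneda Z; fmap A B f := @yoneda_nt (yoneda Z B) A f |}.
Next Obligation. by move=> A B f g; apply: nattransP => T u /=; rewrite compBl. Qed.
Next Obligation. by move=> A; apply: nattransP => T u /=; rewrite comp1m. Qed.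
Next Obligation. by move=> A B E g f; apply: nattransP => T u /=; rewrite compmA. Qed.

Lemma yoneda_functor_ff : fully_faithful yoneda_functor.
Proof.
move=> A B s; exists ((s : nattrans _ _) A (idm Z A)); split.
  by apply: nattransP => T u; rewrite [RHS]yoneda_ntE.
by move=> f <- /=; rewrite compm1.
Qed.

(** By the Yoneda lemma, this is an exact sequence [Z(-, K0) -> Z(-, K1) -> G -> 0]
    whose maps are given by [f] and [g]. *)
Definition pres G K0 K1 (f : hom Z K0 K1) (g : G K1) :=
  (forall T (u : G T), exists c, u = mmap G c g) /\
  forall T (c : hom Z T K1), mmap G c g = 0 <-> exists h, c = f \oc h.

Definition presented (Q : ob -> Prop) G :=
  exists (K0 K1 : ob) (f : hom Z K0 K1) (g : G K1), Q K0 /\ pres f g.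

(** Elements are multiples of the generator, and two multiples are equal under a
    condition on [f] alone; matching the multiples of [g] and [h] is thus well defined. *)
Lemma pres_iso G H K0 K1 (f : hom Z K0 K1) (g : G K1) (h : H K1) :
  pres f g -> pres f h -> isomorphic (modcat Z) G H.
Proof.
move=> [g1 g2] [h1 h2].
have [||||s sP] := @nt_rel _ Z G H
    (fun T u v => exists2 c, u = mmap G c g & v = mmap H c h).
- by move=> T u; have [c ->] := g1 T u; exists (mmap H c h), c.
- by move=> T u v u' v' [c -> ->] [c' -> ->]; exists (c - c'); rewrite mmapBl.
- by move=> T v [c /esym /g2 [e ->] ->]; apply/h2; exists e.
- by move=> T T' a u v [c -> ->]; exists (c \oc a); rewrite mmap_comp.
exists s; apply: nt_bij_iso => T u.
  by have [c -> ->] := sP T u => /h2 [e ->]; apply/g2; exists e.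
have [c ->] := h1 T u; exists (mmap G c g); have [c' e ->] := sP T (mmap G c g).
apply/eqP; rewrite -subr_eq0 -mmapBl; apply/eqP/h2/g2.
by rewrite mmapBl e subrr.
Qed.

Lemma pres_relations G K0 K0' K1 (f : hom Z K0 K1) (f' : hom Z K0' K1) (g : G K1) :
  (exists a, f = f' \oc a) -> (exists b, f' = f \oc b) -> pres f g -> pres f' g.
Proof.
move=> [a ea] [b eb] [g1 g2]; split=> // T c; rewrite g2.
by split=> [[h ->]|[h ->]]; [exists (a \oc h)|exists (b \oc h)];
  rewrite compmA -?ea -?eb.
Qed.

Lemma presentedP Q G : presented Q G <->
  exists (K0 K1 : ob) (a : nattrans (yoneda Z K0) (yoneda Z K1))
    (b : nattrans (yoneda Z K1) G), [/\ Q K0, mod_exact a b & mod_epi b].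
Proof.
split=> [[K0 [K1 [f [g [QK [g1 g2]]]]]]|[K0 [K1 [a [b [QK ex epi]]]]]].
  by exists K0, K1, (fmap yoneda_functor f), (yoneda_nt g).
exists K0, K1, (a K0 (idm Z K0)), (b K1 (idm Z K1)); split=> //; split=> T.
  by move=> u; have [c ->] := epi T u; exists c; rewrite yoneda_ntE.
move=> c; rewrite -yoneda_ntE ex; split=> [[h ->]|[h ->]]; exists h.
  by rewrite yoneda_ntE.
by rewrite [RHS]yoneda_ntE.
Qed.

Lemma yoneda_pres K0 K1 : pres (0 : hom Z K0 K1) (idm Z K1 : yoneda Z K1 K1).
Proof.
split=> [T u|T c] /=; first by exists u; rewrite comp1m.
rewrite comp1m; split=> [->|[h ->]]; last by rewrite comp0m.
by exists 0; rewrite comp0m.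
Qed.

(** By the Yoneda lemma it suffices to lift one element. *)
Lemma yoneda_lift T G H (t : nattrans G H) (s : nattrans (yoneda Z T) H) :
  mod_epi t -> exists r, ntcomp t r = s.
Proof.
move=> epi; have [g eg] := epi _ (s T (idm Z T)).
exists (yoneda_nt g); apply: nattransP => A u /=.
by rewrite nt_nat -eg -yoneda_ntE.
Qed.

Section Additive.
Hypothesis Zadd : is_additive Z.
Variable Q : ob -> Prop.
Hypothesis Qbp : forall A B, Q A -> Q B -> exists b : biprod Z A B, Q (bp_ob b).

(** Horseshoe: lift the generator of the quotient; the relations of the quotient
    then hold up to elements of the submodule. *)
Lemma presented_ext G H (K : modl Z) (s : nattrans G H) (t : nattrans H K) :
  mod_short_exact s t -> presented Q G -> presented Q K -> presented Q H.
Proof.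
move=> [sm st te] [A0 [A1 [f [g [QA [g1 g2]]]]]] [B0 [B1 [f' [k [QB [k1 k2]]]]]].
have [_ bp] := Zadd; have [b1] := bp A1 B1; have [b0 Qb0] := Qbp QA QB.
have [h eh] := te _ k.
have [a ea] : exists a, mmap H f' h = s _ (mmap G a g).
  have /st [v ev] : t _ (mmap H f' h) = 0.
    by rewrite nt_nat -eh; apply/k2; exists (idm Z _); rewrite compm1.
  by have [a ea] := g1 _ v; exists a; rewrite -ea.
pose gen := mmap H (pr1 b1) (s _ g) + mmap H (pr2 b1) h.
have genE T (c : hom Z T (bp_ob b1)) :
    mmap H c gen = s _ (mmap G (pr1 b1 \oc c) g) + mmap H (pr2 b1 \oc c) h.
  by rewrite /gen mmapD -!mmap_comp nt_nat.
(* The entry [- a] corrects the relation [f'], which holds on [h] only up to [s (a g)]. *)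
pose rel := in1 b1 \oc (f \oc pr1 b0 - a \oc pr2 b0) + in2 b1 \oc (f' \oc pr2 b0).
exists (bp_ob b0), (bp_ob b1), rel, gen; split=> //.
split=> [T u|T c].
  have [c ec] := k1 _ (t _ u).
  have /st [v ev] : t _ (u - mmap H c h) = 0 by rewrite nt_B nt_nat -eh ec subrr.
  have [d ed] := g1 _ v; exists (in1 b1 \oc d + in2 b1 \oc c).
  by rewrite genE !bpE -ed -ev subrK.
rewrite genE; split=> [e|[d ->]].
  have /k2 [d ed] : mmap K (pr2 b1 \oc c) k = 0.
    by rewrite eh -nt_nat -(nt_0 t) -e nt_D (_ : t _ (s _ _) = 0) ?add0r //; apply/st; eexists.
  have /g2 [d' ed'] : mmap G (pr1 b1 \oc c + a \oc d) g = 0.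
    by apply: sm; rewrite mmapDl nt_D (mmap_comp a d) (nt_nat s d) -ea -mmap_comp -ed.
  have ec : pr1 b1 \oc c = f \oc d' - a \oc d by rewrite -ed' addrK.
  exists (in1 b0 \oc d' + in2 b0 \oc d); rewrite [c in LHS](bp_split (b := b1)) ed ec.
  by rewrite /rel -?compmA ?bpE -?compmA ?bpE.
rewrite /rel -?compmA ?bpE -?compmA ?bpE mmapBl (mmap_comp a) (mmap_comp f) (mmap_comp f').
rewrite (_ : mmap G f g = 0); last by apply/g2; exists (idm Z _); rewrite compm1.
by rewrite mmap0 sub0r nt_N ea nt_nat addNr.
Qed.

End Additive.

Lemma additive_coprod : is_additive Z -> forall n (A : 'I_n -> ob),
  exists S (i : forall k, hom Z (A k) S) p, coprod_sys i p.
Proof.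
move=> [[O /zero_objectP O0] bp] n A.
have h0 : exists O, idm Z O = 0 /\ True by exists O.
have hb B B' (_ _ : True) : exists b : biprod Z B B', True by have [b] := bp B B'; exists b.
have [S [i [p [_ ip]]]] := coprod_ex (Q := fun=> True) h0 hb (A := A) (fun=> I).
by exists S, i, p.
Qed.

(** The Yoneda embedding preserves finite coproducts, which are given by equations. *)
Lemma free_yoneda P : is_additive Z ->
  free_class (modcat Z) (fun P => exists T, P = yoneda Z T) P ->
  exists S, isomorphic (modcat Z) (yoneda Z S) P.
Proof.
move=> Zadd /free_classP [n [A [i [p [AT ip]]]]].
pose T k := projT1 (cid (AT k)).
have eT k : A k = yoneda Z (T k) by rewrite /T; case: cid.
have [S [j [q jq]]] := additive_coprod Zadd T.
have [|i' [p' ip']] := coprod_sys_iso ip (B := fun k => yoneda Z (T k)).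
  by move=> k; rewrite eT; apply: isomorphic_refl.
exists S; exact: coprod_sys_uniq (fmap_coprod_sys yoneda_functor jq) ip'.
Qed.

Lemma fp_presented G : is_additive Z ->
  finitely_presented G <-> presented (fun=> True) G.
Proof.
move=> Zadd; rewrite presentedP; split.
  move=> [P1 [P0 [s [t [/(free_yoneda Zadd) [S1 [f hf]] /(free_yoneda Zadd) [S0 [f0 hf0]] st te]]]]].
  have [g0 [gf fg]] := hf0; have hg0 : is_iso g0 by exists f0.
  pose f' : nattrans _ _ := f; pose f0' : nattrans _ _ := f0; pose g0' : nattrans _ _ := g0.
  exists S1, S0, (ntcomp g0' (ntcomp s f')), (ntcomp t f0'); split=> //.
    move=> T u /=; rewrite st; split=> [[v ev]|[v ->]].
      have [w ew] := iso_epi hf v; exists w; rewrite /f' -ew -ev /f0' /g0'.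
      by rewrite -[LHS](nt_congr u gf).
    by exists (f' T v); rewrite -[RHS](nt_congr (s T (f' T v)) fg).
  exact: mod_epi_comp (iso_epi hf0) te.
move=> [K0 [K1 [a [b [_ ex epi]]]]]; exists (yoneda Z K0), (yoneda Z K1), a, b.
by split=> //; apply: free_class1; eexists.
Qed.

Lemma presented_fp Q G : presented Q G -> finitely_presented G.
Proof.
move=> /presentedP [K0 [K1 [a [b [_ ex epi]]]]].
exists (yoneda Z K0), (yoneda Z K1), a, b.
by split=> //; apply: free_class1; eexists.
Qed.

Section WeakKernels.
Hypothesis Zadd : is_additive Z.
Hypothesis wker : forall A B (f : hom Z A B), exists (K : ob) (k : hom Z K A),
  f \oc k = 0 /\ forall T (g : hom Z T A), f \oc g = 0 -> exists h, g = k \oc h.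

(** If [x] is the multiple of the generator by [a], then [c] kills [x] exactly when
    [a c = f h] for some [h]; a weak kernel of [(a, - f)] yields all such [c]. *)
Lemma annihilator_generated G : presented (fun=> True) G -> forall T (x : G T),
  exists (W : ob) (w : hom Z W T),
    forall S (c : hom Z S T), mmap G c x = 0 <-> exists h, c = w \oc h.
Proof.
move=> [K0 [K1 [f [g [_ [g1 g2]]]]]] T x; have [a ->] := g1 _ x.
have [_ bp] := Zadd; have [b] := bp T K0.
have [W [w [fw wP]]] := wker (a \oc pr1 b - f \oc pr2 b).
exists W, (pr1 b \oc w) => S c; rewrite -mmap_comp g2; split=> [[h e]|[h ->]].
  have [|k ek] := wP S (in1 b \oc c + in2 b \oc h).
    by rewrite !bpE -!compmA !bpE -e subrr.
  by exists k; rewrite -compmA -ek !bpE.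
exists (pr2 b \oc w \oc h); rewrite !compmA; congr (_ \oc h).
by apply/eqP; rewrite -subr_eq0 -compBl; apply/eqP.
Qed.

(** A multiple of the generator of [G] lies in the kernel when its coefficient
    annihilates the image of the generator. That annihilator provides the generator of
    the kernel, whose own annihilator provides the relations. *)
Lemma presented_ker G H (s : nattrans G H) :
  presented (fun=> True) G -> presented (fun=> True) H ->
  presented (fun=> True) (kermod s).
Proof.
move=> pG pH; have [K0 [K1 [f [g [_ [g1 g2]]]]]] := pG.
have [W [w wP]] := annihilator_generated pH (s _ g).
have /(kerincl_exact s) [x ex] : s _ (mmap G w g) = 0.
  by rewrite nt_nat; apply/wP; exists (idm Z _); rewrite compm1.
have [W' [w' wP']] := annihilator_generated pG (mmap G w g).
exists W', W, w', x; split=> //; split=> [T u|T c].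
  have [c ec] := g1 _ (kerincl s _ u).
  have /wP [h eh] : mmap H c (s _ g) = 0.
    by rewrite -nt_nat -ec; apply/(kerincl_exact s); exists u.
  exists h; apply: (mod_mono_inj (kerincl_mono s)).
  by rewrite nt_nat -ex -mmap_comp -eh.
rewrite -wP' ex -nt_nat; split=> [->|]; first exact: nt_0.
exact: kerincl_mono.
Qed.

End WeakKernels.

(** The image of the generator of [G] becomes one more relation on that of [H]. *)
Lemma presented_coker G H (s : nattrans G H) : is_additive Z ->
  presented (fun=> True) G -> presented (fun=> True) H ->
  presented (fun=> True) (cokermod s).
Proof.
move=> [_ bp] [K0 [K1 [f [g [_ [g1 g2]]]]]] [L0 [L1 [f' [h [_ [h1 h2]]]]]].
have [a ea] := h1 _ (s _ g); have [b] := bp K1 L0.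
exists (bp_ob b), L1, (a \oc pr1 b + f' \oc pr2 b), (cokerproj s _ h); split=> //.
split=> [T u|T c].
  have [v ->] := cokerproj_epi s T u; have [c ->] := h1 _ v; exists c.
  by rewrite nt_nat.
rewrite -nt_nat (cokerproj_exact s); split=> [[v ev]|[k ->]].
  have [d ed] := g1 _ v.
  have /h2 [e ee] : mmap H (c - a \oc d) h = 0.
    by rewrite mmapBl ev ed nt_nat ea -mmap_comp subrr.
  exists (in1 b \oc d + in2 b \oc e).
  by rewrite -[c in LHS](subrK (a \oc d)) ee !bpE -!compmA !bpE addrC.
rewrite compDl mmapDl -!compmA !mmap_comp -ea.
rewrite (_ : mmap H f' h = 0); last by apply/h2; exists (idm Z _); rewrite compm1.
by rewrite !mmap0 addr0 -!nt_nat -?mmap_comp; eexists.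
Qed.

End Presentations.

(** * Long exact sequences *)

Section BifunctorFacts.
Variables (ob : Type) (C : precat ob) (E : bifunctor C).

Lemma pull_0 A B B' (c : hom C B' B) : pull c (0 : E B A) = 0.
Proof. exact: zmod_mor0 (pull_zmod c). Qed.
Lemma push_0 A A' B (a : hom C A A') : push a (0 : E B A) = 0.
Proof. exact: zmod_mor0 (push_zmod a). Qed.
Lemma pullBl A B B' (c c' : hom C B' B) (u : E B A) : pull (c - c') u = pull c u - pull c' u.
Proof. exact: (pull_zmodl u). Qed.
Lemma pushBl A A' B (a a' : hom C A A') (u : E B A) : push (a - a') u = push a u - push a' u.
Proof. exact: (push_zmodl u). Qed.

End BifunctorFacts.

Section LongExact.
Variables (ob : Type) (C : extri ob).

Lemma zero_ex : exists Z, idm C Z = 0.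
Proof. by have [[Z /zero_objectP z] _] := ecat_additive C; exists Z. Qed.

Lemma bp_ex A B : inhabited (biprod C A B).
Proof. exact: (ecat_additive C).2. Qed.

Lemma real_idl A Z : idm C Z = 0 -> real (0 : Ext C Z A) (idm C A) (0 : hom C A Z).
Proof. by move=> z; apply: (real_0 (real_additive C) (biprod0 A z)). Qed.

Lemma real_idr A Z : idm C Z = 0 -> real (0 : Ext C A Z) (0 : hom C Z A) (idm C A).
Proof. by move=> z; apply: (real_0 (real_additive C) (biprod_sym (biprod0 A z))). Qed.

(** Exactness of the Hom sequences of a triangle comes from comparing it with the
    trivial triangles [T = T -> 0] and [0 -> T = T]. *)
Section Triangle.
Variables (A B D : ob) (d : Ext C D A) (x : hom C A B) (y : hom C B D).
Hypothesis r : real d x y.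

Lemma triangle_comp0 : y \oc x = 0.
Proof.
have [Z z] := zero_ex.
have [|c [e _]] := real_ET3 (a := idm C A) (b := x) (real_idl A z) r.
  by [].
by rewrite -e compm0.
Qed.

Lemma triangle_pull : pull y d = 0.
Proof.
have [Z z] := zero_ex.
have [|a [_ <-]] := real_ET3op (b := idm C B) (c := y) (real_idr B z) r.
  by [].
exact: push_0.
Qed.

Lemma hom_lift T (f : hom C T D) : pull f d = 0 -> exists g, f = y \oc g.
Proof.
move=> e; have [Z z] := zero_ex.
have [|b [_ h]] := real_mor (real_additive C) (a := (0 : hom C Z A)) (c := f) (real_idr T z) r.
  by rewrite e push_0.
by exists b; rewrite h compm1.
Qed.

Lemma hom_ext T (f : hom C A T) : push f d = 0 -> exists g, f = g \oc x.
Proof.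
move=> e; have [Z z] := zero_ex.
have [|b [h _]] := real_mor (real_additive C) (a := f) (c := (0 : hom C D Z)) r (real_idl T z).
  by rewrite e pull_0.
by exists b; rewrite h comp1m.
Qed.

Lemma hom_ker T (f : hom C T B) : y \oc f = 0 -> exists g, f = x \oc g.
Proof.
move=> e; have [Z z] := zero_ex.
have [|a [h _]] := real_ET3op (b := f) (c := (0 : hom C Z D)) (real_idl T z) r.
  by rewrite e compm0.
by exists a; rewrite -h compm1.
Qed.

(** The vanishing lets [y] lift to the middle term of a realization of [u], and
    (ET3)^op completes the lift to a morphism of triangles that is the identity on [D]. *)
Lemma ext_push T (u : Ext C D T) : pull y u = 0 -> exists f, u = push f d.
Proof.
move=> e; have [S [t [s ru]]] := real_ex (real_additive C) u.
have [Z z] := zero_ex.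
have [|k [_ h]] := real_mor (real_additive C) (a := (0 : hom C Z T)) (c := y) (real_idr B z) ru.
  by rewrite e push_0.
have [|a [_ ea]] := real_ET3op (b := k) (c := idm C D) r ru.
  by rewrite h compm1 comp1m.
by exists a; rewrite ea pull1.
Qed.

(** Dually, [x] extends to the middle term of a realization of [u]. *)
Lemma ext_pull T (u : Ext C T A) : push x u = 0 -> exists f, u = pull f d.
Proof.
move=> e; have [S [t [s ru]]] := real_ex (real_additive C) u.
have [Z z] := zero_ex.
have [|k [h _]] := real_mor (real_additive C) (a := x) (c := (0 : hom C T Z)) ru (real_idl B z).
  by rewrite e pull_0.
have [|c [_ ec]] := real_ET3 (a := idm C A) (b := k) ru r.
  by rewrite h compm1 comp1m.
by exists c; rewrite -ec push1.
Qed.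

End Triangle.

(** Realizations of zero are the split sequences, here for a biproduct with a zero
    object transported along [f]. *)
Lemma iso_inflation A B (f : hom C A B) Z : is_iso f -> idm C Z = 0 ->
  exists y : hom C B Z, real 0 f y.
Proof.
move=> [g fg] z.
have := real_0 (real_additive C) (transport_biprod (b := biprod0 A z) fg).
by rewrite /= compm1; exists (0 \oc g).
Qed.

Lemma real_deflation A B D (d : Ext C D A) (x : hom C A B) (y : hom C B D) :
  real d x y -> deflation y.
Proof. by exists A, x, d. Qed.

Lemma deflation_comp A B D (f : hom C A B) (g : hom C B D) :
  deflation f -> deflation g -> deflation (g \oc f).
Proof.
move=> [K [i [d r]]] [K' [i' [d' r']]].
have [T [d'' [h' [h [v [u [r'' [eh _ _] _ _ _]]]]]]] := real_ET4op r' r.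
by rewrite -eh; exists T, h', d''.
Qed.

(** This morphism is the sum of [1_A] and [p], followed by the projection of
    [A (+) D] onto [D] twisted by the automorphism with lower left entry [f]. *)
Lemma deflation_pair A P D (b : biprod C A P) (f : hom C A D) (p : hom C P D) :
  deflation p -> deflation (f \oc pr1 b + p \oc pr2 b).
Proof.
move=> [K [i [d r]]]; have [Z z] := zero_ex.
have [bD] := bp_ex A D; have [bK] := bp_ex Z K.
pose N := in2 bD \oc (f \oc pr1 bD).
have NN : N \oc N = 0 by rewrite /N -!compmA !bpE.
have ss' : is_inverse (idm C _ - N) (idm C _ + N).
  by split; rewrite !bpE NN !bpE ?subrK ?addrK // opprD addrA addrK subrr.
have r2 := real_0 (real_additive C) (transport_biprod ss').
have r1 := real_sum (real_additive C) bK b bD (real_idr A z) r.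
have [T [x [d' r3]]] := deflation_comp (real_deflation r1) (real_deflation r2).
exists T, x, d'; move: r3.
rewrite /= /N -!compmA !bpE -!compmA !bpE -?compmA ?bpE.
by rewrite addrC.
Qed.

(** The section shows that the extension is zero, and the realization of zero is
    unique up to isomorphism. *)
Lemma split_deflation A D (q : hom C A D) (s : hom C D A) :
  deflation q -> q \oc s = idm C D ->
  exists (K : ob) (b : biprod C D K) (f : hom C (bp_ob b) A) (g : hom C A (bp_ob b)),
    is_inverse f g /\ q \oc f = pr1 b.
Proof.
move=> [K [i [d r]]] qs.
have d0 : d = 0 by rewrite -(pull1 d) -qs pull_comp (triangle_pull r) pull_0.
have [b] := bp_ex K D.
have rb := real_0 (real_additive C) b.
rewrite d0 in r; have [f [[g fg] _ qf]] := (real_class (real_additive C) i q rb).1 r.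
by exists K, (biprod_sym b), f, g.
Qed.

(** [1_P] lifts to the realization of each [u], so that [u] is zero. *)
Lemma Eproj_idm P : Eproj C P -> Eproj_mor (idm C P).
Proof.
move=> hP T u; have [S [t [s r]]] := real_ex (real_additive C) u.
have [|h e] := hP _ _ s _ (idm C P); first by exists T, t, u.
by rewrite e pull_comp (triangle_pull r) pull_0.
Qed.

End LongExact.

(** * Coresolutions *)
Section Coresolutions.
Variables (ob : Type) (C : extri ob) (X : ob -> Prop).
Hypothesis HX : forall S, X S <-> free_class C X S.

Lemma free_iso A B : isomorphic C A B -> X A -> X B.
Proof.
move=> [f [g [gf fg]]] XA; apply/HX/free_classP.
exists 1%N, (fun=> A), (fun=> f), (fun=> g); split=> //; split=> // [j k|].
  by rewrite !ord1 eqxx.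
by rewrite big_ord1.
Qed.

Lemma free_zero Z : idm C Z = 0 -> X Z.
Proof.
move=> z; apply/HX/free_classP; exists 0%N, (fun=> Z), (fun=> 0), (fun=> 0).
by split=> [[]//|]; split=> [[]//|[]//|]; rewrite big_ord0.
Qed.

Lemma coresolution_inv m K : coresolution C X m K ->
  if m is k.+1 then exists (A K' : ob) (d : Ext C K' K) (x : hom C K A) (y : hom C A K'),
    [/\ X A, real d x y & coresolution C X k K']
  else X K.
Proof.
case=> [{}K A XA KA|{}m {}K A K' x y XA [d r] cK].
  exact: free_iso (isomorphic_sym KA) XA.
by exists A, K', d, x, y.
Qed.

Lemma coresolution_X A : X A -> coresolution C X 0 A.
Proof. by move=> XA; apply: (coresolution_0 XA); apply: isomorphic_refl. Qed.

Lemma coresolution_succ m K : coresolution C X m K -> coresolution C X m.+1 K.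
Proof.
have [Z z] := zero_ex C.
elim=> [{}K A XA [f hf]|{}m {}K A K' x y XA c _ IH].
  have [y r] := iso_inflation hf z.
  apply: (coresolution_S (x := f) (y := y) XA); first by exists 0.
  exact/coresolution_X/free_zero.
exact: coresolution_S XA c IH.
Qed.

Lemma coresolution_leq m k K : (m <= k)%N -> coresolution C X m K -> coresolution C X k K.
Proof.
move=> /subnK <-; elim: (k - m)%N => [//|j IH] cK.
exact/coresolution_succ/IH.
Qed.

Lemma veeP n K : vee C X n K <-> coresolution C X n K.
Proof.
split=> [[m [mn cK]]|cK]; first exact: coresolution_leq cK.
by exists n.
Qed.

Lemma coresolution_biprod m K L (b : biprod C K L) :
  coresolution C X m K -> coresolution C X m L -> coresolution C X m (bp_ob b).
Proof.
elim: m K L b => [|m IH] K L b /coresolution_inv + /coresolution_inv.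
  by move=> XK XL; apply: coresolution_X; apply: (free_biprod HX).
move=> [A [K' [d [x [y [XA r cK]]]]]] [B [L' [d' [x' [y' [XB r' cL]]]]]].
have [bA] := bp_ex C A B; have [bK] := bp_ex C K' L'.
have rs := real_sum (real_additive C) b bA bK r r'.
have XAB : X (bp_ob bA) by apply: (free_biprod HX).
by apply: (coresolution_S XAB); [eexists; exact: rs|exact: IH].
Qed.

Lemma coresolution_zero m Z : idm C Z = 0 -> coresolution C X m Z.
Proof. by move=> z; apply: (@coresolution_leq 0) => //; apply/coresolution_X/free_zero. Qed.

Variables (n : nat) (H : higher_ext C) (Hrig : rigid H n.+2 X).

(** Let [B = K (+) L] and let [B -> A -> D] carry [d]. By (ET4), the cone [T] of
    [K -> B -> A] comes with [v : T -> D] such that its extension [d''] is sent to the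
    pullback of [d] in [E(T, B)]. As [E(D, A) = 0], the component of [d] in [E(D, K)] is
    conversely the pullback of [d''] along some [w : D -> T]. Then [1 - w v] kills
    [d''] and so factors through [A -> T]; hence [T] is a retract of [D (+) A] by a
    deflation, and the induction applies to it. *)
Lemma coresolution_summand m K L (b : biprod C K L) :
  (forall S, X S <-> smd_class C X S) -> (m <= n.+1)%N ->
  coresolution C X m (bp_ob b) -> coresolution C X m K.
Proof.
move=> HS; elim: m K L b => [|m IH] K L b mn /coresolution_inv.
  by move=> Xb; apply/coresolution_X/HS; exists L, b.
move=> [A [D [d [x [y [XA r cD]]]]]].
have [T [d'' [h [h' [u [v [rh [eh _ _] _ _ e]]]]]]] := real_ET4 (real_0 (real_additive C) b) r.
have [w ew] : exists w, push (pr1 b) d = pull w d''.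
  apply: (ext_pull rh); apply: (Ext_vee Hrig) XA; apply/veeP.
  exact: coresolution_leq cD.
have ed : d'' = pull (w \oc v) d''.
  by rewrite pull_comp -ew pull_push -e -push_comp pr1_in1 push1.
have [|g eg] := hom_lift rh (f := idm C T - w \oc v).
  by rewrite pullBl pull1 -ed subrr.
have [bW] := bp_ex C D A.
have hq : deflation (w \oc pr1 bW + h' \oc pr2 bW).
  by apply: deflation_pair; exists K, h, d''.
have [|N [bT [f [f' [ff' _]]]]] := split_deflation (s := in1 bW \oc v + in2 bW \oc g) hq.
  by rewrite -?compmA ?bpE -?compmA ?bpE -eg addrC subrK.
apply: (coresolution_S (x := h) (y := h') XA); first by exists d''.
apply: (IH _ _ (transport_biprod ff') (ltnW mn)) => /=; apply: coresolution_biprod => //.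
by apply: (@coresolution_leq 0) => //; apply: coresolution_X.
Qed.

End Coresolutions.

(** * The stable category and the functor *)
Section StableFunctor.
Variables (ob : Type) (C : extri ob) (X : ob -> Prop) (n : nat).
Hypothesis HX : forall S, X S <-> free_class C X S.

Local Notation V := {K | vee C X n K}.
Local Notation Z := (stable C X n).

Definition st (K L : V) (f : hom C (sval K) (sval L)) : hom Z K L :=
  qpi (ideal_sub (Eproj_ideal C) (vee C X n)) (f : hom (fullsub C (vee C X n)) K L).

Lemma st_full (K L : V) (f : hom Z K L) : exists g, f = st g.
Proof. by exists (repr f); rewrite /st qpi_repr. Qed.

Lemma st_comp (K L M : V) (g : hom C (sval L) (sval M)) (f : hom C (sval K) (sval L)) :
  st (g \oc f) = st g \oc st f.
Proof. by apply: qpi_comp; rewrite qpi_repr. Qed.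

Lemma st1 (K : V) : st (idm C (sval K)) = idm Z K.
Proof. by []. Qed.

Lemma stB (K L : V) (f g : hom C (sval K) (sval L)) : st (f - g) = st f - st g.
Proof. exact: qpiB. Qed.

Lemma st0 (K L : V) : st (0 : hom C (sval K) (sval L)) = 0.
Proof. by rewrite -(subrr 0) stB subrr. Qed.

Lemma stD (K L : V) (f g : hom C (sval K) (sval L)) : st (f + g) = st f + st g.
Proof. by rewrite -{2}(addrK g f) stB subrK. Qed.

Lemma st_eq0 (K L : V) (f : hom C (sval K) (sval L)) : st f = 0 <-> Eproj_mor f.
Proof. by rewrite -(st0 K L) -{2}(subr0 f); apply: qpi_eq. Qed.

Lemma st_biprod (K L : V) (b : biprod C (sval K) (sval L)) :
  exists b' : biprod Z K L, sval (bp_ob b') = bp_ob b.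
Proof.
have hb : vee C X n (bp_ob b).
  by apply/(veeP HX); apply: (coresolution_biprod HX); apply/(veeP HX); apply: svalP.
have [b' e] := fullsub_biprod hb.
by exists (fmap_biprod (qfun (ideal_sub (Eproj_ideal C) (vee C X n))) b').
Qed.

Lemma st_additive : is_additive Z.
Proof.
split.
  have [O o] := zero_ex C.
  have hO : vee C X n O by apply/(veeP HX); apply: (coresolution_zero HX).
  by exists (exist _ O hO); apply/zero_objectP; rewrite -st1 /= o st0.
move=> K L; have [b] := bp_ex C (sval K) (sval L).
by have [b' _] := st_biprod b; exact: (inhabits b').
Qed.

Lemma st_biprod_X (K L : V) : X (sval K) -> X (sval L) ->
  exists b : biprod Z K L, X (sval (bp_ob b)).
Proof.
move=> XK XL; have [b] := bp_ex C (sval K) (sval L).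
by have [b' e] := st_biprod b; exists b'; rewrite e; apply: (free_biprod HX).
Qed.

Lemma vee_X A : X A -> vee C X n A.
Proof. by exists 0%N; split=> //; apply: coresolution_X. Qed.

Lemma Emod_st (M : ob) (K L : V) (f : hom C (sval K) (sval L)) (u : Emod C X n M L) :
  mmap (Emod C X n M) (st f) u = pull f (u : Ext C (sval L) M).
Proof.
by apply: pull_stable; apply: (repr_qpi (ideal_sub (Eproj_ideal C) (vee C X n))).
Qed.

Definition Xobj (K : V) := X (sval K).

Lemma inR_presented (G : modl Z) : inR G <-> presented Xobj G.
Proof. by rewrite presentedP. Qed.

Variables (H : higher_ext C) (Hrig : rigid H n.+2 X).

Local Notation D := (vee_quot n HX).
Local Notation F := (functorF HX Hrig).

(** For [K] in [vee n], a conflation [M -> A -> M'] with [A] in [X] identifies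
    [E(K, M)] with the cokernel of [C(K, A) -> C(K, M')]: since [E(K, A) = 0], its
    extension generates [E(-, M)], and its deflation generates the relations. *)
Lemma Emod_pres M (KA KM : V) (d : Ext C (sval KM) M) (x : hom C M (sval KA))
    (y : hom C (sval KA) (sval KM)) :
  X (sval KA) -> real d x y -> pres (G := Emod C X n M) (st y) d.
Proof.
move=> XA r; split=> [K u|K c].
  have [|c ec] := ext_pull r (u := u).
    exact: (Ext_vee Hrig) (svalP K) XA.
  by exists (st c); rewrite Emod_st -ec.
have [c' ->] := st_full c; rewrite Emod_st; split=> [/(hom_lift r) [h ->]|[h]].
  by exists (st h); rewrite st_comp.
have [h' ->] := st_full h; rewrite -st_comp => e.
have <- : pull (y \oc h') d = pull c' d by rewrite -!(Emod_st (L := KM)) e.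
by rewrite pull_comp (triangle_pull r) pull_0.
Qed.

(** An object of [X] also has such a conflation, since coresolutions can be
    lengthened by zero. *)
Lemma vee_succ M : vee C X n.+1 M <-> exists (KA KM : V) (d : Ext C (sval KM) M) x y,
  X (sval KA) /\ real d x (y : hom C (sval KA) (sval KM)).
Proof.
rewrite (veeP HX); split.
  move=> /(coresolution_inv HX) [A [K [d [x [y [XA r /(veeP HX) cK]]]]]].
  by exists (exist _ A (vee_X XA)), (exist _ K cK), d, x, y.
move=> [KA [KM [d [x [y [XA r]]]]]].
by apply: (coresolution_S XA (ex_intro _ d r)); apply/(veeP HX)/svalP.
Qed.

Definition dq (A B : {M | vee C X n.+1 M}) (f : hom C (sval A) (sval B)) : hom D A B :=
  qpi (factor_ideal HX) f.

Lemma dq_full A B (f : hom D A B) : exists g, f = dq g.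
Proof. by exists (repr f); rewrite /dq qpi_repr. Qed.

Lemma dq_comp (A B E : {M | vee C X n.+1 M}) (g : hom C (sval B) (sval E))
    (f : hom C (sval A) (sval B)) : dq (g \oc f) = dq g \oc dq f.
Proof. by apply: qpi_comp; rewrite qpi_repr. Qed.

Lemma dq1 (A : {M | vee C X n.+1 M}) : dq (idm C (sval A)) = idm D A.
Proof. by []. Qed.

Lemma dqB (A B : {M | vee C X n.+1 M}) (f g : hom C (sval A) (sval B)) :
  dq (f - g) = dq f - dq g.
Proof. exact: qpiB. Qed.

Lemma dq0 (A B : {M | vee C X n.+1 M}) : dq (0 : hom C (sval A) (sval B)) = 0.
Proof. by rewrite -(subrr 0) dqB subrr. Qed.

Lemma dq_eq0 (A B : {M | vee C X n.+1 M}) (f : hom C (sval A) (sval B)) :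
  dq f = 0 <-> factors X f.
Proof. by rewrite -(dq0 A B) -{2}(subr0 f); apply: qpi_eq. Qed.

Lemma F_dq (A B : {M | vee C X n.+1 M}) (f : hom C (sval A) (sval B)) (K : V) u :
  fnt F (dq f) K u = push f (u : Ext C (sval K) (sval A)).
Proof. by apply: (push_factor Hrig); apply: (repr_qpi (factor_ideal HX)). Qed.

Lemma F_presented M : presented Xobj (F M).
Proof.
have [KA [KM [d [x [y [XA r]]]]]] := (vee_succ (sval M)).1 (svalP M).
by exists KA, KM, (st y), d; split=> //; apply: Emod_pres r.
Qed.

(** A natural transformation is determined by its value on the extension [d] that
    generates [E(-, A)]. The deflation [y] kills this value, which is therefore
    the pushout of [d] along some [f]; two choices of [f] differ by a morphism that
    kills [d], that is, one that factors through the middle term of the conflation. *)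
Lemma F_ff : fully_faithful F.
Proof.
move=> A B s; have [KA [KM [d [x [y [XA r]]]]]] := (vee_succ (sval A)).1 (svalP A).
have [gen _] := Emod_pres XA r.
pose s' : nattrans (Emod C X n (sval A)) (Emod C X n (sval B)) := s.
have [|f ef] := ext_push r (u := s' KM d).
  by rewrite -Emod_st -nt_nat Emod_st (triangle_pull r) nt_0.
exists (dq f); split=> [|g].
  apply: nattransP => K u; have [c ->] := gen K u.
  rewrite [LHS](F_dq f (K := K)); have [c' ->] := st_full c.
  by rewrite Emod_st -pull_push -ef -Emod_st -nt_nat Emod_st.
have [g' ->] := dq_full g => eg.
have : push (f - g') d = 0.
  by rewrite pushBl -ef -(F_dq g' (K := KM)) [fnt F _]eg subrr.
move=> /(hom_ext r) [h eh]; apply/eqP; rewrite -subr_eq0 -dqB; apply/eqP/dq_eq0.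
by exists (sval KA), h, x.
Qed.

Hypothesis Hproj : enough_Eproj_mor C (vee C X n) X.

(** A relation [f : K0 -> K1] becomes a deflation after adding to it an
    [E]-projective deflation, which is zero in the stable category; its cocone
    is the wanted object. *)
Lemma F_surj (G : modl Z) : presented Xobj G -> exists M, isomorphic (modcat Z) G (F M).
Proof.
move=> [K0 [K1 [f [g [XK p]]]]]; have [f' ef] := st_full f.
have [P [q [XP dq qE]]] := Hproj (svalP K1).
have [b] := bp_ex C (sval K0) P; have [M [x [d r]]] := deflation_pair b f' dq.
pose KP : V := exist _ P (vee_X XP).
have XA : X (bp_ob b) by apply: (free_biprod HX).
pose KA : V := exist _ (bp_ob b) (vee_X XA).
have hM : vee C X n.+1 M by apply/vee_succ; exists KA, K1, d, x, (f' \oc pr1 b + q \oc pr2 b).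
exists (exist _ M hM).
have q0 : st (K := KP) (L := K1) q = 0 by apply/st_eq0.
have e : st (K := KA) (L := K1) (f' \oc pr1 b + q \oc pr2 b) =
    f \oc st (K := KA) (L := K0) (pr1 b).
  by rewrite stD (st_comp (L := KP)) q0 comp0m addr0 st_comp -ef.
have pM := Emod_pres (KA := KA) XA r.
apply: (pres_iso (H := Emod C X n M) _ pM).
apply: pres_relations p; last by rewrite e; eexists.
by exists (st (K := K0) (L := KA) (in1 b)); rewrite e -compmA -st_comp pr1_in1 compm1.
Qed.

End StableFunctor.

Arguments F_ff {ob C X n} HX {H} Hrig.

(** * Objects with local endomorphism ring *)
Section LocalObjects.
Variables (ob : Type) (C : precat ob).

(** Terms with zero identity contribute nothing to the sum of the idempotents. *)
Lemma coprod_sys_nonzero n (A : 'I_n -> ob) S (i : forall k, hom C (A k) S) p :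
  coprod_sys i p -> exists m (t : 'I_m -> 'I_n) j q,
    (forall k, idm C (A (t k)) <> 0) /\ @coprod_sys _ C m (fun k => A (t k)) S j q.
Proof.
move=> [h1 h2 h3]; pose P := [pred k | idm C (A k) != 0].
pose t (k : 'I_#|P|) := enum_val k.
exists #|P|, t, (fun k => i (t k)), (fun k => p (t k)); split.
  by move=> k; have := enum_valP k; rewrite inE => /eqP.
split=> [k|j k jk|]; [exact: h1| |].
  by apply: h2; apply: contraNneq jk => e; apply/eqP/enum_val_inj.
rewrite -h3 [RHS](bigID P) /= [X in _ + X]big1 ?addr0.
  by rewrite -(big_enum_val (A := P) (fun k => i k \oc p k)).
by move=> k /negPn/eqP e; rewrite -(comp1m (p k)) e comp0m compm0.
Qed.

(** An inverse of [f + g] lifts to [h] in [C], and [h (f + g)] is the identity up to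
    a morphism [e] that [F] kills; it suffices to apply locality to [h f] and
    [h g - e]. *)
Lemma local_full ob2 (D : precat ob2) (F : functor C D) A :
  (forall A B (g : hom D (F A) (F B)), exists f, fmap F f = g) ->
  idm D (F A) <> 0 -> has_local_end C A -> has_local_end D (F A).
Proof.
move=> full nz [_ loc]; split=> // f g [h [hfg fgh]].
have ih : is_iso h by exists (f + g).
have [f0 ef] := full _ _ f; have [g0 eg] := full _ _ g; have [h0 eh] := full _ _ h.
pose e := h0 \oc (f0 + g0) - idm C A.
have e0 : fmap F e = 0.
  by rewrite fmapB fmap_comp fmapD ef eg eh hfg fmap1 subrr.
have : is_iso (h0 \oc f0 + (h0 \oc g0 - e)).
  by rewrite addrA -compDr /e opprB addrCA subrr addr0; apply: is_iso_idm.
move=> /loc [/(fmap_iso F)|/(fmap_iso F)].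
  by rewrite fmap_comp ef eh => /(is_iso_cancel ih); left.
by rewrite fmapB e0 subr0 fmap_comp eg eh => /(is_iso_cancel ih); right.
Qed.

Lemma local_sum n A (f : 'I_n -> hom C A A) : has_local_end C A ->
  \sum_k f k = idm C A -> exists k, is_iso (f k).
Proof.
move=> [nz loc] e; have : is_iso (\sum_k f k) by rewrite e; apply: is_iso_idm.
elim: n f {e} => [|n IH] f.
  by rewrite big_ord0 => -[g []]; rewrite compm0 => /esym /nz.
by rewrite big_ord_recl => /loc [|/IH [k]]; [exists ord0|exists (lift ord0 k)].
Qed.

Lemma local_idempotent A (e : hom C A A) : has_local_end C A -> e \oc e = e ->
  e = idm C A \/ e = 0.
Proof.
move=> [_ loc] ee; have : is_iso (e + (idm C A - e)).
  by rewrite addrC subrK; apply: is_iso_idm.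
move=> /loc [[g [ge _]]|[g [ge _]]].
  by left; rewrite -(comp1m e) -ge -compmA ee.
right; rewrite -(comp1m e) -ge -compmA compBl comp1m ee subrr.
by rewrite compm0.
Qed.

(** The idempotent [s (p s)^-1 p] of the local object [B] is [1] or [0], and [0]
    would kill [A]. *)
Lemma retract_local A B (s : hom C A B) (p : hom C B A) :
  has_local_end C B -> idm C A <> 0 -> is_iso (p \oc s) -> isomorphic C A B.
Proof.
move=> locB nz [g [gps psg]].
have ee : (s \oc (g \oc p)) \oc (s \oc (g \oc p)) = s \oc (g \oc p).
  by rewrite -!compmA (compmA p s) (compmA (p \oc s)) psg comp1m.
have [e|e] := local_idempotent locB ee.
  by exists s, (g \oc p); split; rewrite -?compmA.
have : idm C A = (g \oc p) \oc (s \oc (g \oc p)) \oc s.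
  by rewrite -!compmA gps compm1 gps.
by rewrite e compm0 comp0m => /nz.
Qed.

Lemma kernel_of_retraction A B K (p : hom C A B) (i : hom C K A) r s :
  p \oc i = 0 -> r \oc i = idm C K -> i \oc r = idm C A - s \oc p -> is_kernel p i.
Proof.
move=> pi ri ir; split=> // T g pg; exists (r \oc g); split=> [|h <-].
  by rewrite compmA ir compBl -compmA pg compm0 comp1m subr0.
by rewrite compmA ri comp1m.
Qed.

Lemma summand_proj A B (b : biprod C A B) : is_proj C (bp_ob b) -> is_proj C A.
Proof.
move=> pb S T p ep g; have [h eh] := pb _ _ _ ep (g \oc pr1 b).
by exists (h \oc in1 b); rewrite compmA -eh -compmA pr1_in1 compm1.
Qed.

End LocalObjects.

(** * Equivalences onto subcategories of modules *)
Section Equivalences.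
Variables (ob1 ob2 : Type) (D : precat ob1) (Z : precat ob2) (F : functor D (modcat Z)).
Variables (R : modl Z -> Prop) (HR : forall M, R (F M)).
Hypothesis ff : fully_faithful F.
Hypothesis surj : forall G, R G -> in_image F G.

Lemma corestrict_ff : fully_faithful (corestrict HR).
Proof. exact: ff. Qed.

Lemma corestrict_surj (G : {G | R G}) :
  exists M, isomorphic (fullsub (modcat Z) R) (corestrict HR M) G.
Proof.
have [M hM] := surj (svalP G); exists M.
by have [f [g fg]] := isomorphic_sym hM; exists f, g.
Qed.

Lemma corestrict_equivalence : is_equivalence (corestrict HR).
Proof.
exists (inv_functor corestrict_ff corestrict_surj).
exact: inv_functor_quasi_inverse.
Qed.

Lemma corestrict_exact_equivalence :
  is_exact_equivalence (corestrict HR) (ses_preimage F)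
    (ses_preimage (inclusion (modcat Z) R)).
Proof.
have q := inv_functor_quasi_inverse corestrict_ff corestrict_surj.
exists (inv_functor corestrict_ff corestrict_surj); split=> // A B T i p ip.
have [_ [th [thi thn]]] := q.
have [a' ha] := thi A; have [b' hb] := thi B; have [c' hc] := thi T.
have e1 := inverse_square ha hb (esym (thn _ _ i)).
have e2 := inverse_square hb hc (esym (thn _ _ p)).
apply: (@ses_iso _ Z _ _ _ _ _ _ i p _ _ a' b' c' _ _ _ e1 e2 ip).
- by exists (th A); apply: is_inverse_sym.
- by exists (th B); apply: is_inverse_sym.
- by exists (th T); apply: is_inverse_sym.
Qed.

End Equivalences.

(** * The exact equivalence *)
Section Main.
Variables (ob : Type) (C : extri ob) (H : higher_ext C) (n : nat) (X : ob -> Prop).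
Hypothesis HX : forall S, X S <-> free_class C X S.
Hypothesis Hrig : rigid H n.+2 X.
Hypothesis Hproj : enough_Eproj_mor C (vee C X n) X.

Local Notation V := {K | vee C X n K}.
Local Notation Z := (stable C X n).
Local Notation D := (vee_quot n HX).
Local Notation F := (functorF HX Hrig).
Local Notation DO := {M | vee C X n.+1 M}.

Lemma F_inR M : inR (F M).
Proof. exact/inR_presented/F_presented. Qed.

Lemma F_in_image G : inR G -> in_image F G.
Proof. by move=> /inR_presented; apply: F_surj. Qed.

Lemma inR_ext (A B G : modl Z) (s : nattrans A G) (t : nattrans G B) :
  mod_short_exact s t -> inR A -> inR B -> inR G.
Proof.
move=> ses /inR_presented pA /inR_presented pB; apply/inR_presented.
apply: presented_ext ses pA pB; first exact: st_additive.
exact: st_biprod_X.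
Qed.

Lemma inR_mod0 : inR (mod0 Z).
Proof.
have [O o] := zero_ex C; have XO := free_zero HX o.
pose K : V := exist _ O (vee_X C n XO).
apply/inR_presented; exists K, K, (idm Z K), 0; split=> //; split=> [T u|T c].
  by exists 0; rewrite mmap0l; apply: ord1.
by rewrite mmap0; split=> // _; exists c; rewrite comp1m.
Qed.

Lemma F_zero : exists M, forall A (u : F M A), u = 0.
Proof.
have [M [f hf]] := F_in_image inR_mod0; exists M => A u.
by have [v ->] := iso_epi hf u; rewrite [v]ord1 nt_0.
Qed.

Lemma F_ext A B (G : modl Z) (s : nattrans (F A) G) (t : nattrans G (F B)) :
  mod_short_exact s t -> in_image F G.
Proof.
by move=> ses; apply: F_in_image; apply: inR_ext ses _ _; apply: F_inR.
Qed.

Lemma epsF_exact : is_exact_category (epsF HX Hrig).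
Proof. exact: (preimage_exact (F_ff HX Hrig) F_zero F_ext). Qed.

Lemma epsR_exact : is_exact_category (epsR C X n).
Proof.
apply: (preimage_exact (@inclusion_ff _ (modcat Z) (@inR _ C X n))).
  by exists (exist _ _ inR_mod0) => A u; apply: ord1.
move=> A B G s t ses; exists (exist _ G (inR_ext ses (svalP A) (svalP B))).
exact: isomorphic_refl.
Qed.

Program Definition dq_functor : functor (fullsub C (vee C X n.+1)) D :=
  {| fob A := A; fmap A B f := dq HX f |}.
Next Obligation. by move=> A B f g; apply: dqB. Qed.
Next Obligation. by []. Qed.
Next Obligation. by move=> A B E g f; apply: dq_comp. Qed.

Lemma dq_functor_full A B (g : hom D A B) : exists f, fmap dq_functor f = g.
Proof. by have [f ->] := dq_full g; exists f. Qed.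

(** * Weak idempotent completeness and the Krull-Schmidt property *)
Section SummandClosed.
Hypothesis HS : forall S, X S <-> smd_class C X S.

Lemma vee_summand K L (b : biprod C K L) : vee C X n.+1 (bp_ob b) -> vee C X n.+1 K.
Proof.
move=> /(veeP HX) cb; apply/(veeP HX).
exact: (coresolution_summand HX Hrig HS (leqnn _) cb).
Qed.

Lemma dq_factor (A B : DO) (W : ob) (g : hom C W (sval B)) (h : hom C (sval A) W) :
  X W -> dq HX (g \oc h) = 0.
Proof. by move=> XW; apply/dq_eq0; exists W, g, h. Qed.

(** If [p s - 1] factors through [K] in [X] and [q : P -> B] is a deflation from [X],
    then [A (+) K (+) P -> B] is a deflation of [C] with a section, and it agrees with
    [p] modulo [X]. Its cocone [N] splits off, so it is an object of the category. *)
Lemma vee_quot_wic : enough_deflations C (vee C X n.+1) X -> weakly_idempotent_complete D.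
Proof.
move=> Hd A B p [s ps].
have [p0 ep] := dq_full p; have [s0 es] := dq_full s.
have /dq_eq0 [K [g [h [XK egh]]]] : dq HX (p0 \oc s0 - idm C (sval B)) = 0.
  by rewrite dqB dq_comp -ep -es ps dq1 subrr.
have [P [q [XP dfq]]] := Hd _ (svalP B).
have [b1] := bp_ex C K P; have [b] := bp_ex C (sval A) (bp_ob b1).
have Xb1 : X (bp_ob b1) by apply: (free_biprod HX).
set r := g \oc pr1 b1 + q \oc pr2 b1.
have ht : deflation (p0 \oc pr1 b + r \oc pr2 b) by do 2!apply: deflation_pair.
set t := _ + _ in ht.
have ts : t \oc (in1 b \oc s0 - in2 b \oc (in1 b1 \oc h)) = idm C (sval B).
  rewrite /t /r -?compmA ?bpE -?compmA ?bpE -?compmA ?bpE -egh.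
  by rewrite opprB addrCA subrr addr0.
have [N [b0 [f [f' [ff' tf]]]]] := split_deflation ht ts.
have [f'f ff] := ff'.
have hN : vee C X n.+1 N.
  apply: (@vee_summand _ _ (transport_biprod (b := biprod_sym b0) ff')) => /=.
  apply/(veeP HX); apply: (coresolution_biprod HX); apply/(veeP HX); first exact: svalP.
  exact: vee_X.
pose M : DO := exist _ N hN.
(* [N] and [A] are compared inside [A (+) K (+) P]; modulo [X], the morphism [rho] is a
   retraction of [i], and [i rho] is [1 - s' p] for a section [s'] of [p]. *)
pose i := pr1 b \oc (f \oc in2 b0); pose rho := pr2 b0 \oc (f' \oc in1 b).
exists M, (@dq _ _ _ _ HX M A i).
have tE : t \oc in1 b = p0 by rewrite /t -?compmA ?bpE -?compmA ?bpE.
have pE : p0 \oc pr1 b = t - r \oc pr2 b by rewrite addrK.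
have p0i : p0 \oc i = - ((r \oc pr2 b) \oc (f \oc in2 b0)).
  by rewrite /i compmA pE compBl (compmA t) tf pr1_in2 sub0r.
have ri : rho \oc i = idm C N - (pr2 b0 \oc (f' \oc in2 b)) \oc (pr2 b \oc (f \oc in2 b0)).
  rewrite /rho /i; apply/esym/eqP; rewrite subr_eq -!compmA -!compDr.
  by rewrite -bp_split (compmA f') f'f comp1m pr2_in2.
have ir : i \oc rho = idm C (sval A) - (pr1 b \oc (f \oc in1 b0)) \oc p0.
  apply/esym/eqP; rewrite subr_eq addrC.
  rewrite /rho /i -tE -[t](compm1) -ff (compmA t) tf -!compmA -!compDr.
  by rewrite -bp_split (compmA f) ff comp1m pr1_in1.
apply: (kernel_of_retraction (r := @dq _ _ _ _ HX A M rho)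
  (s := @dq _ _ _ _ HX B A (pr1 b \oc (f \oc in1 b0)))).
- rewrite ep -dq_comp p0i -sub0r dqB dq0 -compmA dq_factor ?subrr //.
- by rewrite -dq_comp ri dqB dq_factor // subr0 dq1.
- by rewrite ep -!dq_comp ir dqB.
Qed.

(** A decomposition in [C] stays inside the category, by closure under summands, and
    keeps its local terms in the quotient, apart from those that become zero. *)
Lemma vee_quot_KS : Krull_Schmidt C -> Krull_Schmidt D.
Proof.
move=> KS M; have /free_classP [m [A [i [p [loc ip]]]]] := KS (sval M).
have hA k : vee C X n.+1 (A k).
  have [S' [b eb]] := coprod_summand (ecat_additive C) ip k.
  by apply: (vee_summand (b := b)); rewrite eb; apply: svalP.
pose A' k : DO := exist _ (A k) (hA k).
have ip' : @coprod_sys _ (fullsub C (vee C X n.+1)) m A' M i p by [].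
have [m' [t [j [q [nz jq]]]]] := coprod_sys_nonzero (fmap_coprod_sys dq_functor ip').
apply/free_classP; exists m', (fun k => A' (t k)), j, q; split=> // k.
have lk : has_local_end (fullsub C (vee C X n.+1)) (A' (t k)) := loc (t k).
exact: (@local_full _ _ _ _ dq_functor _ dq_functor_full (nz k) lk).
Qed.

End SummandClosed.

(** * The abelian case *)
Section Abelian.
Hypothesis HV : forall M, vee C X n M <-> X M.
Hypothesis Hpre : precovering C X (vee C X n.+1).

(** An [E]-projective deflation completes [f] to a deflation; a cover of the cocone of
    the latter, projected to [K], is a weak kernel. It captures all [g] with [f g = 0] in the
    stable category because an [E]-projective morphism factors through every deflation. *)
Lemma st_weak_kernels (K L : V) (f : hom Z K L) : exists (W : V) (w : hom Z W K),
  f \oc w = 0 /\ forall (T : V) (g : hom Z T K), f \oc g = 0 -> exists h, g = w \oc h.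
Proof.
have [f0 ->] := st_full f; have [P [q [XP dfq qE]]] := Hproj (svalP L).
have [N [z [dz rz]]] := dfq.
have [b] := bp_ex C (sval K) P; have [M [x [d r]]] := deflation_pair b f0 dfq.
pose KP : V := exist _ P (vee_X C n XP).
have Xb : X (bp_ob b) by apply: (free_biprod HX) => //; apply/HV/svalP.
pose KA : V := exist _ (bp_ob b) (vee_X C n Xb).
have [|W [e [XW eP]]] := Hpre (M := M).
  by apply/(vee_succ n HX); exists KA, L, d, x, (f0 \oc pr1 b + q \oc pr2 b).
pose KW : V := exist _ W (vee_X C n XW).
exists KW, (st (K := KW) (L := K) (pr1 b \oc (x \oc e))); split.
  rewrite -st_comp; apply/st_eq0.
  have : (f0 \oc pr1 b + q \oc pr2 b) \oc (x \oc e) = 0.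
    by rewrite compmA (triangle_comp0 r) comp0m.
  rewrite compDl -!compmA => /eqP; rewrite addr_eq0 -compNr => /eqP ->.
  by move=> T u; rewrite pull_comp qE pull_0.
move=> T g; have [g0 ->] := st_full g; rewrite -st_comp => /st_eq0 hg.
have [|k ek] := hom_lift rz (f := f0 \oc g0); first exact: hg.
have [|u eu] := hom_ker r (f := in1 b \oc g0 - in2 b \oc k).
  by rewrite -?compmA ?bpE -?compmA ?bpE ek subrr.
have [u' eu'] := eP _ u ((HV _).1 (svalP T)).
exists (st (K := T) (L := KW) u'); rewrite -st_comp; congr st.
by rewrite -!compmA -eu' -eu !bpE.
Qed.


Lemma presented_inR (G : modl Z) : presented (fun=> True) G -> inR G.
Proof.
move=> [K0 [K1 [f [g [_ p]]]]]; apply/inR_presented; exists K0, K1, f, g.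
by split=> //; apply/HV/svalP.
Qed.

Lemma inR_presentedT (G : modl Z) : inR G -> presented (fun=> True) G.
Proof.
move=> /inR_presented [K0 [K1 [f [g [_ p]]]]].
by exists K0, K1, f, g.
Qed.

Lemma F_ker A B (f : hom D A B) : in_image F (kermod (fnt F f)).
Proof.
apply/F_in_image/presented_inR.
apply: (presented_ker (st_additive n HX) st_weak_kernels); exact/inR_presentedT/F_inR.
Qed.

Lemma F_coker A B (f : hom D A B) : in_image F (cokermod (fnt F f)).
Proof.
apply/F_in_image/presented_inR.
apply: (presented_coker _ (st_additive n HX)); exact/inR_presentedT/F_inR.
Qed.

Lemma epsF_abelian : is_abelian_exact_category (epsF HX Hrig).
Proof.
exact: (preimage_abelian_exact (F_ff HX Hrig) F_zero F_ext F_ker F_coker).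
Qed.

Lemma fpE (G : modl Z) : finitely_presented G <-> inR G.
Proof.
rewrite (fp_presented _ (st_additive n HX)); split; [exact: presented_inR|exact: inR_presentedT].
Qed.

Lemma fp_abelian : is_abelian (fullsub (modcat Z) (@finitely_presented _ Z)).
Proof.
have hp (M : {G : modl Z | finitely_presented G}) : inR (sval M) by apply/fpE/svalP.
have im (G : modl Z) : inR G -> in_image (inclusion (modcat Z) (@finitely_presented _ Z)) G.
  by move=> /fpE hG; exists (exist _ G hG); apply: isomorphic_refl.
apply: (preimage_abelian (@inclusion_ff _ (modcat Z) (@finitely_presented _ Z))).
- by have h := (fpE _).2 inR_mod0; exists (exist _ _ h) => A u; apply: ord1.
- by move=> A B G s t ses; apply: im; apply: inR_ext ses (hp A) (hp B).
- move=> A B f; apply/im/presented_inR.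
  by apply: (presented_ker (st_additive n HX) st_weak_kernels); apply/inR_presentedT/hp.
- move=> A B f; apply/im/presented_inR.
  by apply: (presented_coker _ (st_additive n HX)); apply/inR_presentedT/hp.
Qed.

(** * Projective objects *)

Hypothesis Heproj : enough_Eproj C.
Hypothesis HP : forall P, Eproj C P -> X P.

(** The morphism [P -> T] is zero in the stable category, because [1_P] is an
    [E]-projective morphism; hence [E(-, K)] is presented without relations. *)
Lemma Omega_yoneda (K : DO) (T : V) P (d : Ext C (sval T) (sval K)) (x : hom C (sval K) P)
    (y : hom C P (sval T)) :
  Eproj C P -> real d x y -> isomorphic (modcat Z) (yoneda Z T) (F K).
Proof.
move=> pP r; pose KP : V := exist _ P (vee_X C n (HP pP)).
have p := Emod_pres Hrig (KA := KP) (HP pP) r.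
have y0 : st (K := KP) (L := T) y = 0.
  by apply/st_eq0; rewrite -(compm1 y) => S u; rewrite pull_comp (Eproj_idm pP).
by rewrite y0 in p; apply: pres_iso (yoneda_pres Z KP T) p.
Qed.

Lemma Omega_representable (K : DO) : Omega C X (sval K) ->
  exists T : V, isomorphic (modcat Z) (yoneda Z T) (F K).
Proof.
move=> [P [A [x [y [pP XA [d r]]]]]].
pose T : V := exist _ A (vee_X C n XA).
by exists T; apply: (@Omega_yoneda K T P d x y).
Qed.

Lemma representable_Omega (T : V) : exists K : DO,
  Omega C X (sval K) /\ isomorphic (modcat Z) (yoneda Z T) (F K).
Proof.
have [P [y [pP [M [x [d r]]]]]] := Heproj (sval T).
have hM : vee C X n.+1 M.
  by apply/(vee_succ n HX); exists (exist _ P (vee_X C n (HP pP))), T, d, x, y; split=> //; apply: HP.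
exists (exist _ M hM); split; last exact: (@Omega_yoneda (exist _ M hM) T P d x y).
by exists P, (sval T), x, y; split=> //; [apply/HV/svalP|exists d].
Qed.

Lemma representable_proj (M : DO) (T : V) :
  isomorphic (modcat Z) (yoneda Z T) (F M) -> is_proj D M.
Proof.
move=> [f [g fg]] A B p ep q.
have pe := preimage_epi (F_ff HX Hrig) F_coker ep.
have [r er] := yoneda_lift (ntcomp (fnt F q) f) pe.
have [h eh] := fnt_full (F_ff HX Hrig) (ntcomp r g).
exists h; apply: (fnt_inj (F_ff HX Hrig)) => K u.
rewrite fnt_comp eh /=; have [_ e] := fg.
rewrite -[LHS]/(fnt F q K (nt1 _ K u)) -[nt1 _]e.
exact: esym (nt_congr _ er).
Qed.

(** The generator of [F M] gives an epimorphism from a representable functor, which is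
    [F K] for a syzygy [K]; it splits by projectivity. *)
Lemma proj_cover (M : DO) : is_proj D M -> exists (T : V) (K : DO)
    (phi : hom (modcat Z) (yoneda Z T) (F K)) (e : hom D K M) (s : hom D M K),
  [/\ Omega C X (sval K), is_iso phi & e \oc s = idm D M].
Proof.
move=> pM; have [_ [T [_ [g [_ [gen _]]]]]] := F_presented HX Hrig M.
have [K [hK [phi [psi pp]]]] := representable_Omega T.
have [e ee] := fnt_full (F_ff HX Hrig) (ntcomp (yoneda_nt g) psi).
have epi : is_epi e.
  move=> S a b ab; apply: (fnt_inj (F_ff HX Hrig)) => L u.
  have [c ->] := gen L u; have ip : is_iso psi by exists phi; apply: is_inverse_sym.
  have [v ev] := iso_epi ip c.
  have <- : fnt F e L v = mmap (F M) c g by rewrite ee ev.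
  by rewrite -!fnt_comp ab.
have [s es] := pM _ _ e epi (idm D M).
by exists T, K, phi, e, s; split=> //; exists psi.
Qed.

Lemma proj_summand (M : DO) : is_proj D M <-> smd_class D (fun K => Omega C X (sval K)) M.
Proof.
split=> [/proj_cover [T [K [phi [e [s [hK _ es]]]]]]|[S [b /Omega_representable [T hT]]]].
  have [N [i [im ie]]] := preimage_ker_ex (F_ff HX Hrig) F_ker e.
  have [b eb] := split_biprod es (fnt_kernel (F_ff HX Hrig) im ie).
  by exists N, b; rewrite eb.
exact: summand_proj (representable_proj hT).
Qed.

Section KrullSchmidt.
Hypothesis HKS : Krull_Schmidt C.
Hypothesis HS : forall S, X S <-> smd_class C X S.

(** [F M] is a retract of a representable functor, which decomposes along a decomposition
    of its representing object in [C]. Locality makes [F M] a retract of one of the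
    terms, and this term has a local endomorphism ring, so it is isomorphic to [F M]. *)
Lemma local_proj_Omega (M : DO) : has_local_end D M -> is_proj D M ->
  exists K : DO, Omega C X (sval K) /\ isomorphic D M K.
Proof.
move=> locM pM; have [T [K [phi [e [s [hK [psi [_ pp]] es]]]]]] := proj_cover pM.
have /free_classP [m [A [i [p [locA ip]]]]] := HKS (sval T).
have XA k : X (A k).
  apply/HS; have [S' [b eb]] := coprod_summand (ecat_additive C) ip k.
  by exists S', b; rewrite eb; apply/HV/svalP.
pose A' k : V := exist _ (A k) (vee_X C n (XA k)).
have ip' : @coprod_sys _ (fullsub C (vee C X n)) m A' T i p by [].
pose Q := qfun (ideal_sub (Eproj_ideal C) (vee C X n)).
pose ii k := fmap (yoneda_functor Z) (fmap Q (i k : hom (fullsub C _) (A' k) T)).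
pose qq k := fmap (yoneda_functor Z) (fmap Q (p k : hom (fullsub C _) T (A' k))).
have sm : \sum_k ii k \oc qq k = idm (modcat Z) (yoneda Z T).
  by have [] := fmap_coprod_sys (yoneda_functor Z) (fmap_coprod_sys Q ip').
pose a : hom (modcat Z) (F M) (yoneda Z T) := psi \oc fmap F s.
pose c : hom (modcat Z) (yoneda Z T) (F M) := fmap F e \oc phi.
have ca : c \oc a = idm (modcat Z) (F M).
  by rewrite /c /a -compmA (compmA phi) pp comp1m -fmap_comp es fmap1.
have locF : has_local_end (modcat Z) (F M).
  apply: (local_full (F := F) _ _ locM); first exact: (ff_full (F_ff HX Hrig)).
  by move=> /(ff_zero (F_ff HX Hrig)); case: locM.
have [|k hk] := local_sum (f := fun k => (c \oc ii k) \oc (qq k \oc a)) locF.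
  rewrite -ca -[a in RHS]comp1m -sm comp_suml comp_sumr; apply: eq_bigr => k _.
  by rewrite -!compmA.
have [K' [hK' hT']] := representable_Omega (A' k); exists K'; split=> //.
apply: (ff_isomorphic (F_ff HX Hrig)); apply: isomorphic_trans hT'.
have nzF : idm (modcat Z) (F M) <> 0 by case: locF.
have nzy : idm (modcat Z) (yoneda Z (A' k)) <> 0.
  move=> z; apply: nzF; have [g [gk _]] := hk; rewrite -gk.
  by rewrite -(comp1m (qq k \oc a)) z comp0m !compm0.
have nzA : idm Z (A' k) <> 0.
  by move=> z; apply: nzy; rewrite -(fmap1 (yoneda_functor Z)) z fmap0.
have locA' : has_local_end (fullsub C (vee C X n)) (A' k) := locA k.
apply: (retract_local (s := qq k \oc a) (p := c \oc ii k)) => //.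
apply: (local_full (F := yoneda_functor Z)) => //; first exact: (ff_full (@yoneda_functor_ff _ Z)).
by apply: (local_full (F := Q)) => // ? ? ?; apply: qfun_full.
Qed.

Lemma Omega_zero : exists K : DO, idm D K = 0 /\ Omega C X (sval K).
Proof.
have [O o] := zero_ex C.
have hO : vee C X n.+1 O by apply/(veeP HX); apply: (coresolution_zero HX).
exists (exist _ O hO); split; first by rewrite -dq1 /= o dq0.
have zr T (f : hom C O T) : f = 0 by rewrite -(compm1 f) o compm0.
exists O, O, (idm C O), 0; split; last by exists 0; apply: real_idl.
- by move=> B E y _ g; exists 0; rewrite compm0 (zr _ g).
- exact: free_zero o.
Qed.

Lemma Omega_biprod (K L : DO) : Omega C X (sval K) -> Omega C X (sval L) ->
  exists b : biprod D K L, Omega C X (sval (bp_ob b)).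
Proof.
move=> [P [A [x [y [pP XA [d r]]]]]] [P' [A' [x' [y' [pP' XA' [d' r']]]]]].
have [b] := bp_ex C (sval K) (sval L).
have hb : vee C X n.+1 (bp_ob b).
  by apply/(veeP HX); apply: (coresolution_biprod HX); apply/(veeP HX); apply: svalP.
have [b' eb] := fullsub_biprod hb.
exists (fmap_biprod dq_functor b'); rewrite /= eb.
have [bP] := bp_ex C P P'; have [bA] := bp_ex C A A'.
exists (bp_ob bP), (bp_ob bA); eexists; eexists; split.
- move=> B E q hq g; have [h eh] := pP _ _ q hq (g \oc in1 bP).
  have [h' eh'] := pP' _ _ q hq (g \oc in2 bP).
  exists (h \oc pr1 bP + h' \oc pr2 bP).
  by rewrite compDr !compmA -eh -eh' -!compmA -compDr bp_sum compm1.
- exact: (free_biprod HX).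
- eexists; exact: (real_sum (real_additive C) b bP bA r r').
Qed.

Lemma proj_Omega (M : DO) : is_proj D M <->
  exists K : DO, Omega C X (sval K) /\ isomorphic D M K.
Proof.
split=> [pM|[K [/Omega_representable [T hT] MK]]]; last first.
  apply: (representable_proj (T := T)); apply: isomorphic_trans hT _.
  exact/fob_iso/isomorphic_sym.
have /free_classP [m [A [i [p [locA ip]]]]] := vee_quot_KS HS HKS M.
have hA k : {K : DO | Omega C X (sval K) /\ isomorphic D (A k) K}.
  apply/cid; apply: local_proj_Omega => //.
  have [S' [b eb]] := coprod_summand (preimage_additive (F_ff HX Hrig) F_zero F_ext) ip k.
  by apply: (summand_proj (b := b)); rewrite eb.
have [j [q jq]] := coprod_sys_iso ip (fun k => (svalP (hA k)).2).
have [S [j' [q' [hS jq']]]] := coprod_ex Omega_zero Omega_biprod (fun k => (svalP (hA k)).1).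
by exists S; split=> //; apply: coprod_sys_uniq jq jq'.
Qed.

End KrullSchmidt.
End Abelian.
End Main.

Theorem theorem3p18 (ob : Type) (C : extri ob) (H : higher_ext C) (n : nat)
    (X : ob -> Prop)
    (HX : forall S, X S <-> free_class C X S)
    (Hrig : rigid H n.+2 X)
    (Hproj : enough_Eproj_mor C (vee C X n) X) :
  let D := vee_quot n HX in
  let Z := stable C X n in
  let F : functor D (modcat Z) := functorF HX Hrig in
  [/\ (* F is a fully faithful functor to fp Z *)
      fully_faithful F /\ (forall M, finitely_presented (F M)),
      (* (a) *)
      (exists HR : forall M, inR (F M),
         [/\ is_exact_category (epsR C X n),
             is_exact_category (epsF HX Hrig)
           & is_exact_equivalence (corestrict HR) (epsF HX Hrig)
               (epsR C X n)]) /\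
      ((forall S, X S <-> smd_class C X S) ->
         (* (a1) *)
         (enough_deflations C (vee C X n.+1) X ->
            weakly_idempotent_complete D) /\
         (* (a2) *)
         (Krull_Schmidt C -> Krull_Schmidt D))
    & (* (b) *)
      (forall M, vee C X n M <-> X M) -> precovering C X (vee C X n.+1) ->
      (* (b1) *)
      (is_abelian_exact_category (epsF HX Hrig) /\
       exists HP : forall M, finitely_presented (F M),
         is_abelian (fullsub (modcat Z) (@finitely_presented _ Z)) /\
         is_equivalence (corestrict HP)) /\
      (* (b2) *)
      (enough_Eproj C -> (forall P, Eproj C P -> X P) ->
         (forall M, is_proj D M <->
            smd_class D (fun K => Omega C X (sval K)) M) /\
         (Krull_Schmidt C -> (forall S, X S <-> smd_class C X S) ->
            forall M, is_proj D M <->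
              exists K, Omega C X (sval K) /\ isomorphic D M K))].
Proof.
have HF M := presented_fp (F_presented HX Hrig M).
split; first by split; [exact: F_ff|exact: HF].
  split.
    exists (F_inR HX Hrig); split.
    - exact: epsR_exact.
    - exact: epsF_exact.
    - have h := @corestrict_exact_equivalence _ _ _ _ (functorF HX Hrig) (@inR _ C X n) (F_inR HX Hrig) (F_ff HX Hrig) (F_in_image HX Hrig Hproj).
      exact: h.
  by move=> HS; split; [exact: (vee_quot_wic Hrig HS)|exact: (vee_quot_KS HX Hrig HS)].
move=> HV Hpre; split.
  split; first exact: epsF_abelian.
  exists HF; split; first exact: (fp_abelian HX Hproj HV Hpre).
  apply: corestrict_equivalence (F_ff HX Hrig) _ => G hG.
  by apply: (F_in_image HX Hrig Hproj); apply/(fpE HX HV).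
move=> Heproj HP; split=> [M|HKS HS M].
  exact: (proj_summand HX Hrig Hproj HV Hpre Heproj HP M).
exact: (proj_Omega HX Hrig Hproj HV Heproj HP HKS HS M).
Qed.
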